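(* For any $n\in\mathbb N$ and any $\varphi\in C_0(\mathbb R)\setminus\{0\}$ we have $$\overline{\mathcal N_\varphi^\infty(\mathbb R^n)}=\overline{\mathcal N_\varphi^1(\mathbb R^n)}=C_{\mathcal R}(\mathbb R^n).$$ Moreover, for every $m\in\mathbb N$ (networks with $m$ output nodes), $$\overline{\mathcal N_\varphi^\infty(\mathbb R^n,\mathbb R^m)}=C_{\mathcal R}(\mathbb R^n)^{\oplus m}.$$
   Context: $\mathbb N=\{1,2,\ldots\}$. For a finite-dimensional real inner product space $V$, $C_0(V)$ is the space of continuous functions $f:V\to\mathbb R$ with $\lim_{\|x\|\to\infty}f(x)=0$ (for $V=\{0\}$ this is $\mathbb R$). For a function $\varphi:\mathbb R\to\mathbb R$ define the real vector spaces of functions $\mathbb R^n\to\mathbb R$ $$\mathcal N_\varphi^1(\mathbb R^n):=\operatorname{span}\{x\mapsto\varphi(a\cdot x+b)\mid a\in\mathbb R^n,\ b\in\mathbb R\},$$ recursively for $l\ge2$, $$\mathcal N_\varphi^l(\mathbb R^n):=\operatorname{span}\{x\mapsto\varphi(f(x)+b)\mid f\in\mathcal N_\varphi^{l-1}(\mathbb R^n),\ b\in\mathbb R\},$$ and $\mathcal N_\varphi^\infty(\mathbb R^n):=\bigcup_{l\ge1}\mathcal N_\varphi^l(\mathbb R^n)$. For $m$ outputs, $\mathcal N_\varphi^l(\mathbb R^n,\mathbb R^m):=\mathcal N_\varphi^l(\mathbb R^n)^{\oplus m}$ (functions $\mathbb R^n\to\mathbb R^m$ all of whose components lie in $\mathcal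 N_\varphi^l(\mathbb R^n)$) and $\mathcal N_\varphi^\infty(\mathbb R^n,\mathbb R^m):=\bigcup_{l\ge1}\mathcal N_\varphi^l(\mathbb R^n,\mathbb R^m)$. Overline denotes uniform closure (closure with respect to the supremum norm over $\mathbb R^n$), and $\overline{\operatorname{span}}\,S:=\overline{\operatorname{span}S}$ with $\mathbb R$-linear span. The (real-valued part of the) commutative resolvent algebra is $$C_{\mathcal R}(\mathbb R^n):=\overline{\operatorname{span}}\{g\circ P_V\mid V\subseteq\mathbb R^n\text{ linear subspace},\ g\in C_0(V)\},$$ where $P_V:\mathbb R^n\to V$ is the orthogonal projection onto $V$. *)

(* Defs.v *)
From HB Require Import structures.
From mathcomp Require Import all_boot all_order all_algebra.
From mathcomp Require Import all_classical all_reals all_analysis.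

Set Implicit Arguments.
Unset Strict Implicit.
Unset Printing Implicit Defensive.
Import Order.TTheory GRing.Theory Num.Theory.
Import numFieldNormedType.Exports.

Local Open Scope classical_set_scope.
Local Open Scope ring_scope.

Definition dot (R : realType) (n : nat) (u v : 'rV[R]_n) : R :=
  \sum_(i < n) u ord0 i * v ord0 i.

(* The library norm on 'rV[R]_n is the sup norm; this is the Euclidean one. *)
Definition enorm (R : realType) (n : nat) (u : 'rV[R]_n) : R :=
  Num.sqrt (dot u u).

(* f tends to 0 on A as N x -> +oo; vacuous when N is bounded on A. *)
Definition vanishes_at_infinity (R : realType) (T : Type) (N : T -> R)
    (A : set T) (f : T -> R) : Prop :=
  forall e : R, 0 < e -> exists M : R,
    forall x : T, A x -> M < N x -> `|f x| < e.

Definition C0R (R : realType) : set (R -> R) :=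
  [set f | continuous f /\
           vanishes_at_infinity (fun x : R => `|x|) [set: R] f].

(* Elements of C_0(V) are represented by functions on the ambient space whose
   restriction to V is in C_0(V); their values outside V are irrelevant. *)
Definition C0V (R : realType) (n : nat) (V : {vspace 'rV[R]_n}) :
    set ('rV[R]_n -> R) :=
  [set g | {within [set x | x \in V], continuous g} /\
           vanishes_at_infinity (@enorm R n) [set x | x \in V] g].

(* This determines P uniquely. *)
Definition is_orthoproj (R : realType) (n : nat) (V : {vspace 'rV[R]_n})
    (P : 'rV[R]_n -> 'rV[R]_n) : Prop :=
  forall x, P x \in V /\ forall v, v \in V -> dot (x - P x) v = 0.

Definition lspan (R : realType) (T : Type) (S : set (T -> R)) :
    set (T -> R) :=
  [set f | exists (k : nat) (c : 'I_k -> R) (g : 'I_k -> (T -> R)),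
     (forall i, S (g i)) /\ f = (fun x => \sum_(i < k) c i * g i x)].

(* {uniform T -> U} carries the topology of uniform convergence on T. *)
Definition uniform_closure (T : choiceType) (U : uniformType)
    (S : set (T -> U)) : set (T -> U) :=
  @closure {uniform T -> U} S.

(* The layer count l starts at 1; the value at l = 0 is junk. *)
Fixpoint network (R : realType) (phi : R -> R) (n l : nat) :
    set ('rV[R]_n -> R) :=
  match l with
  | 0 => set0
  | 1 => lspan [set h | exists (a : 'rV[R]_n) (b : R),
                   h = (fun x => phi (dot a x + b))]
  | S l' => lspan [set h | exists (f : 'rV[R]_n -> R) (b : R),
                   network phi l' f /\ h = (fun x => phi (f x + b))]
  end.

Definition network_oo (R : realType) (phi : R -> R) (n : nat) :
    set ('rV[R]_n -> R) :=
  \bigcup_(l in [set l : nat | (1 <= l)%N]) network phi l.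

Definition components_in (R : realType) (n m : nat)
    (S : set ('rV[R]_n -> R)) : set ('rV[R]_n -> 'rV[R]_m) :=
  [set F | forall j : 'I_m, S (fun x => F x ord0 j)].

Definition network_multi (R : realType) (phi : R -> R) (n m l : nat) :
    set ('rV[R]_n -> 'rV[R]_m) :=
  components_in (network phi l).

Definition network_multi_oo (R : realType) (phi : R -> R) (n m : nat) :
    set ('rV[R]_n -> 'rV[R]_m) :=
  \bigcup_(l in [set l : nat | (1 <= l)%N]) network_multi phi l.

Definition resolvent_algebra (R : realType) (n : nat) :
    set ('rV[R]_n -> R) :=
  uniform_closure (lspan
    [set f | exists (V : {vspace 'rV[R]_n}) (P : 'rV[R]_n -> 'rV[R]_n)
                    (g : 'rV[R]_n -> R),
       [/\ is_orthoproj V P, C0V V g & f = g \o P]]).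

(* Main.v *)
(* Let A be the uniform closure of the one-layer networks.

   The ridge functions psi (a . x + b), psi in C_0(R), all lie in A. Indeed
   let E be a closed, affine-invariant space of functions on R containing a
   nonzero phi in C_0(R). Second differences u of a double primitive of phi
   are in C_0(R), with u'' in E, and one may take u with a positive maximum,
   at t say. Then psi x = (u' (t + x) - u' (t - x)) / (2 x), a mean of
   dilates of u'', is in E, and its integral over R is half that of (u (t +
   x) + u (t - x) - 2 u t) / x^2, hence negative. So the primitive of psi is
   a sigmoid; rescaled second differences of a primitive of the latter
   converge uniformly to the hat function, and hats interpolate every
   function of C_0(R).

   A is an algebra: this reduces to products of Cauchy kernels 1 / (1 +
   t^2), which Feynman's formula writes as means of ridge functions along a
   segment. Means along segments are uniform limits of Riemann sums,
   uniformly in both endpoints, because a function in C_0(R) is uniformly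
   continuous with respect to a bounded monotone function of its argument.

   As A is closed under products and, by Neumann series, under f |-> 1 / (1
   + f^2), it is closed under composition with C_0(R), so deeper networks
   stay in A. Products of hats in the coordinates of P_V x interpolate g o
   P_V, so the resolvent algebra is contained in A. *)
Require Import Defs.
From mathcomp Require Import all_boot all_order all_algebra ring lra.
From mathcomp Require Import all_classical all_reals all_analysis.
Set Implicit Arguments.
Unset Strict Implicit.
Unset Printing Implicit Defensive.
Import Order.TTheory GRing.Theory Num.Theory.
Import numFieldNormedType.Exports.
Local Open Scope classical_set_scope.
Local Open Scope ring_scope.

(** * Uniform closure and uniform continuity on compact sets *)

Lemma uniform_closureP (R : realType) (T : choiceType) (U : normedModType R)
    (S : set (T -> U)) f :
  uniform_closure S f <->
  forall e : R, 0 < e -> exists2 g, S g & forall x, `|f x - g x| < e.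
Proof.
split.
  move=> Sf e e0.
  have : nbhs (f : {uniform T -> U}) [set g | forall x, `|f x - g x| < e].
    apply/uniform_nbhs.
    exists [set xy | ball xy.1 e xy.2]; split.
      by rewrite -entourage_from_ballE; exists e.
    by move=> g /= fg x; have := fg x I; rewrite -ball_normE.
  by move=> /Sf [g [Sg fg]]; exists g.
move=> H B /uniform_nbhs [E [+ EB]].
rewrite -entourage_from_ballE => -[e /= e0 eE].
have [g Sg fg] := H e e0; exists g; split => //; apply: EB => x _.
by apply: eE => /=; rewrite -ball_normE; exact: fg.
Qed.

(** Compactness, in its near-covering form, merges the local moduli into one. Only [x] is confined
    to [K]; [y] may leave it. *)
Lemma heine (R : realType) (V : normedModType R) (f : V -> R) (K : set V)
    (e : R) : compact K -> continuous f -> 0 < e ->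
  exists2 d : R, 0 < d &
    forall x y, K x -> `|x - y| < d -> `|f x - f y| < e.
Proof.
move=> /compact_near_coveringP cK cf e0.
have e20 : 0 < e / 2 by rewrite divr_gt0.
have := cK R (0^'+)
  (fun d x => forall y, `|x - y| < d -> `|f x - f y| < e).
case.
- move=> x Kx.
  have /cvgrPdist_lt/(_ _ e20)/nbhs_normP[d /= d0 fd] := cf x.
  exists (ball x (d / 2), [set i | i < d / 2]) => /=.
    split; first by apply: nbhsx_ballx; rewrite divr_gt0.
    by apply: nbhs_right_lt; rewrite divr_gt0.
  move=> [x' i] /= [xx' id] y x'y.
  rewrite -ball_normE /= in xx'.
  have fx' : `|f x - f x'| < e / 2 by apply: fd => /=; lra.
  have fy : `|f x - f y| < e / 2.
    apply: fd => /=; rewrite -(subrKA x'); apply: le_lt_trans (ler_normD _ _) _.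
    lra.
  rewrite -(subrKA (f x)); apply: le_lt_trans (ler_normD _ _) _.
  by rewrite (distrC (f x')); lra.
- move=> d /= d0 H; exists (d / 2); first by rewrite divr_gt0.
  move=> x y Kx; apply: H => //=; last by rewrite divr_gt0.
  by rewrite sub0r normrN gtr0_norm ?divr_gt0//; lra.
Qed.

(** * Primitives and the mean value theorem *)

Section Antiderivatives.
Context {R : realType}.
Implicit Types f g F G : R -> R.

Definition antiderivative F f := forall x : R, is_derive x (1 : R) F (f x).

Lemma antiderivative_continuous F f : antiderivative F f -> continuous F.
Proof.
by move=> Ff x; apply/differentiable_continuous/derivable1_diffP/ex_derive.
Qed.

Lemma antiderivative_exists f : continuous f -> exists F, antiderivative F f.
Proof.
move=> cf.
pose mu := @lebesgue_measure R.
have fi (a b : R) : mu.-integrable `[a, b] (EFin \o f).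
  apply: continuous_compact_integrable; first exact: segment_compact.
  exact: continuous_subspaceT.
pose F x := if 0 <= x then (\int[mu]_(t in `]0, x]) f t)
            else - (\int[mu]_(t in `]x, 0]) f t).
exists F => x.
(* As [a] lies to the left of both 0 and [x], near [x] the function [F] is the integral from [a]
   minus a constant, and the fundamental theorem of calculus applies. *)
pose a : R := - `|x| - 1.
have a0 : a < 0 by rewrite /a; have := normr_ge0 x; lra.
have ax : a < x by rewrite /a; have := lerNnormlW (lexx `|x|); lra.
pose I y := \int[mu]_(t in `[a, y]) f t.
have FI y : a < y -> I y - I 0 = F y.
  move=> ay; rewrite /F /I; case: ifPn => [y0|]; last rewrite -ltNge => y0.
    by rewrite Rintegral_itvB// bnd_simp ltW.
  by rewrite -opprB Rintegral_itvB// bnd_simp ltW.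
apply: (near_eq_is_derive (f := fun y => I y - I 0)).
  near=> y; apply: FI; near: y; exact: lt_nbhsr.
have x1 : x < x + 1 by rewrite ltrDl.
have [dI dIE] := @continuous_FTC1_closed R f a x (x + 1) x1 (fi a (x + 1)) ax
  (cf x).
have -> : f x = f x - 0 by rewrite subr0.
apply: is_deriveB.
by apply: DeriveDef; [exact: dI|rewrite -derive1E; exact: dIE].
Unshelve. all: by end_near. Qed.

(** Writing the intermediate point as [a + s * d] covers both signs of [d] and [d = 0] at once. *)
Lemma mean_value G g : antiderivative G g -> forall a d,
  exists2 s, 0 <= s <= 1 & G (a + d) - G a = g (a + s * d) * d.
Proof.
move=> Gg a d; have cG := antiderivative_continuous Gg.
have [d0|d0|->] := ltgtP d 0.
- have [|c /=] := MVT (f := G) (df := g) (a := a + d) (b := a) ltac:(lra)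
    (fun x _ => Gg x); first exact: continuous_subspaceT.
  rewrite in_itv /= => /andP[c1 c2] H; exists ((c - a) / d).
    apply/andP; split; first by rewrite ler_ndivlMr//; lra.
    by rewrite ler_ndivrMr//; lra.
  have -> : a + (c - a) / d * d = c by rewrite divfK ?lt_eqF//; lra.
  have -> : G (a + d) - G a = - (G a - G (a + d)) by rewrite opprB.
  by rewrite H; lra.
- have [|c /=] := MVT (f := G) (df := g) (a := a) (b := a + d) ltac:(lra)
    (fun x _ => Gg x); first exact: continuous_subspaceT.
  rewrite in_itv /= => /andP[c1 c2] H; exists ((c - a) / d).
    apply/andP; split; first by rewrite ler_pdivlMr//; lra.
    by rewrite ler_pdivrMr//; lra.
  have -> : a + (c - a) / d * d = c by rewrite divfK ?gt_eqF//; lra.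
  by rewrite H; lra.
- by exists 0; rewrite ?lexx ?ler01// addr0 subrr !mulr0.
Qed.

End Antiderivatives.

(** * Uniform continuity of functions vanishing at infinity *)

Section C0.
Context {R : realType}.
Implicit Types f g psi : R -> R.

(* Increasing and bounded: it turns the telescoping of a Riemann sum into a
   bound that is uniform in the endpoints. *)
Definition softsign (x : R) := x / (1 + `|x|).

Lemma softsign_lt1 x : `|softsign x| < 1.
Proof.
have x0 := normr_ge0 x.
rewrite /softsign normrM normfV [X in _ / X]ger0_norm; last lra.
by rewrite ltr_pdivrMr; lra.
Qed.

(** Over the common denominator the numerator is [y - x] plus [y |x| - x |y|]. The latter is 0 if
    [x] and [y] have the same sign and [- 2 x y >= 0] otherwise. *)
Lemma softsign_lb x y : x <= y ->
  (y - x) / ((1 + `|x|) * (1 + `|y|)) <= softsign y - softsign x.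
Proof.
move=> xy; have x0 := normr_ge0 x; have y0 := normr_ge0 y.
have -> : softsign y - softsign x =
    (y * (1 + `|x|) - x * (1 + `|y|)) / ((1 + `|x|) * (1 + `|y|)).
  by rewrite /softsign; field; apply/andP; split; rewrite gt_eqF//; lra.
rewrite ler_pM2r; last by rewrite invr_gt0 mulr_gt0//; lra.
case: (lerP 0 x) => x1; case: (lerP 0 y) => y1; rewrite ?(ger0_norm x1)
  ?(ger0_norm y1) ?(ltr0_norm x1) ?(ltr0_norm y1); try lra.
by have : 0 <= - x * y by [rewrite mulr_ge0; lra]; lra.
Qed.

Lemma softsign_le x y : x <= y -> softsign x <= softsign y.
Proof.
move=> xy; rewrite -subr_ge0; apply: le_trans (softsign_lb xy).
by rewrite divr_ge0 ?mulr_ge0 ?subr_ge0 ?addr_ge0.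
Qed.

Lemma softsign_lip x y : x <= y -> softsign y - softsign x <= y - x.
Proof.
move=> xy; have x0 := normr_ge0 x; have y0 := normr_ge0 y.
have -> : softsign y - softsign x =
    (y * (1 + `|x|) - x * (1 + `|y|)) / ((1 + `|x|) * (1 + `|y|)).
  by rewrite /softsign; field; apply/andP; split; rewrite gt_eqF//; lra.
rewrite ler_pdivrMr; last by rewrite mulr_gt0//; lra.
case: (lerP 0 x) => x1; case: (lerP 0 y) => y1; rewrite ?(ger0_norm x1)
  ?(ger0_norm y1) ?(ltr0_norm x1) ?(ltr0_norm y1).
- have h : 0 <= x * y by rewrite mulr_ge0.
  have : 0 <= x * y * (y - x) by rewrite mulr_ge0; lra.
  have : 0 <= x * (y - x) by rewrite mulr_ge0; lra.
  have : 0 <= y * (y - x) by rewrite mulr_ge0; lra.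
  lra.
- lra.
- have h : 0 <= - x * y by rewrite mulr_ge0; lra.
  have : 0 <= - x * y * (y - x) by rewrite mulr_ge0; lra.
  have := sqr_ge0 x; have := sqr_ge0 y.
  lra.
- have h : 0 <= (- x) * (- y) by rewrite mulr_ge0; lra.
  have : 0 <= (- x) * (- y) * (y - x) by rewrite mulr_ge0; lra.
  have : 0 <= - x * (y - x) by rewrite mulr_ge0; lra.
  have : 0 <= - y * (y - x) by rewrite mulr_ge0; lra.
  lra.
Qed.

Lemma C0R_bounded f : C0R f -> exists2 C, 0 < C & forall x, `|f x| <= C.
Proof.
move=> [cf vf]; have [M HM] := vf 1 ltr01.
pose m := `|M|.
have m0 : 0 <= m by exact: normr_ge0.
have cnf : {within `[- m, m], continuous (fun x => `|f x|)}.
  apply: continuous_subspaceT => x.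
  exact: (@cvg_norm _ _ _ _ _ f _ (cf x)).
have [c _ Hc] := EVT_max (f := fun x => `|f x|) (a := - m) (b := m)
  ltac:(lra) cnf.
exists (`|f c| + 1); first by have := normr_ge0 (f c); lra.
move=> x; have [xm|xm] := leP `|x| m.
  have := Hc x; rewrite in_itv /= -ler_norml xm => /(_ isT); lra.
have := HM x I (le_lt_trans (ler_norm M) xm); have := normr_ge0 (f c); lra.
Qed.

(** Three cases: both points far out, where [f] is small; points closer than [d], where uniform
    continuity on a compact interval applies; and points at distance at least [d], one of them in
    [[- M, M]], where [softsign] grows by at least [c] and [K = 2 C / c] pays for the whole
    oscillation of [f]. *)
Lemma C0R_tame f : C0R f -> forall e, 0 < e ->
  exists2 K, 0 < K & forall x y, x <= y ->
    `|f x - f y| <= e + K * (softsign y - softsign x).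
Proof.
move=> Cf e e0; have [C C0 HC] := C0R_bounded Cf.
have [cf vf] := Cf.
have e20 : 0 < e / 2 by rewrite divr_gt0.
have [M0 HM0] := vf _ e20.
pose M := `|M0| + 1; have M1 : 1 <= M by rewrite /M; have := normr_ge0 M0; lra.
have HM x : M < `|x| -> `|f x| < e / 2.
  move=> Mx; apply: HM0 => //.
  by move: Mx; rewrite /M; have := ler_norm M0; lra.
have [d0 d00 Hd0] := heine (@segment_compact R (- M) M) cf e0.
pose d := Num.min d0 1.
have d_gt0 : 0 < d by rewrite lt_min d00 ltr01.
have d1 : d <= 1 by rewrite ge_min lexx orbT.
have Hd x y : `|x| <= M -> `|x - y| < d -> `|f x - f y| < e.
  move=> xM xy; apply: Hd0; first by rewrite /= in_itv /= -ler_norml.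
  by apply: lt_le_trans xy _; rewrite ge_min lexx.
(* This is the bound of [softsign_lb] on an interval of length [d] with one end in [[- M, M]]; the
   other end is at most [M + 1] in absolute value because [d <= 1]. *)
pose c := d / ((2 + M) * (2 + M)).
have c0 : 0 < c by rewrite divr_gt0// mulr_gt0; lra.
have far x y : (`|x| <= M) || (`|y| <= M) -> d <= y - x ->
    c <= softsign y - softsign x.
  move=> /orP[] xM dxy.
    apply: (@le_trans _ _ (softsign (x + d) - softsign x)); last first.
      by rewrite lerD2r; apply: softsign_le; lra.
    apply: le_trans (softsign_lb _); last lra.
    have -> : x + d - x = d by lra.
    rewrite ler_pM2l// lef_pV2 ?posrE; last 2 first.
    - by rewrite mulr_gt0; lra.
    - by rewrite mulr_gt0// addr_gt0.
    have := normr_ge0 x; have := normr_ge0 (x + d) => ? ?.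
    apply: ler_pM; [lra|lra|lra|].
    have := ler_normD x d; rewrite (gtr0_norm d_gt0); lra.
  apply: (@le_trans _ _ (softsign y - softsign (y - d))); last first.
    by rewrite lerD2l lerN2; apply: softsign_le; lra.
  apply: le_trans (softsign_lb _); last lra.
  have -> : y - (y - d) = d by lra.
  rewrite ler_pM2l// lef_pV2 ?posrE; last 2 first.
  - by rewrite mulr_gt0; lra.
  - by rewrite mulr_gt0// ltr_pwDl.
  have := normr_ge0 y; have := normr_ge0 (y - d) => ? ?.
  apply: ler_pM; [lra|lra| |lra].
  have := ler_normB y d; rewrite (gtr0_norm d_gt0); lra.
exists (2 * C / c); first by rewrite divr_gt0// mulr_gt0.
move=> x y xy; have muxy := softsign_le xy.
have Kmu : 0 <= 2 * C / c * (softsign y - softsign x).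
  by rewrite mulr_ge0 ?subr_ge0// divr_ge0//; lra.
have [nr|nr] := boolP ((`|x| <= M) || (`|y| <= M)); last first.
  move: nr; rewrite negb_or -!ltNge => /andP[/HM xM /HM yM].
  have := ler_normB (f x) (f y); lra.
have [dxy|dxy] := leP d (y - x).
  have H : 2 * C <= 2 * C / c * (softsign y - softsign x).
    rewrite mulrAC ler_pdivlMr// ler_pM2l; last lra.
    exact: far.
  have := ler_normB (f x) (f y); have := HC x; have := HC y; lra.
have nxy : `|x - y| < d by rewrite distrC ger0_norm//; lra.
suff : `|f x - f y| < e by lra.
case/orP: nr => zM; first exact: Hd.
by rewrite distrC; apply: Hd => //; rewrite distrC.
Qed.

(** As [softsign] is 1-Lipschitz, [C0R_tame] contains ordinary uniform continuity. *)
Lemma C0R_unif f : C0R f -> forall e, 0 < e ->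
  exists2 d, 0 < d & forall x y, `|x - y| <= d -> `|f x - f y| < e.
Proof.
move=> Cf e e0; have [|K K0 HK] := C0R_tame Cf (e := e / 2).
  by rewrite divr_gt0.
exists (e / (4 * K)); first by rewrite divr_gt0// mulr_gt0.
have H x y : x <= y -> y - x <= e / (4 * K) -> `|f x - f y| < e.
  move=> xy; rewrite ler_pdivlMr ?mulr_gt0// => yx.
  have := HK _ _ xy; have := softsign_lip xy.
  by move=> /(ler_wpM2l (ltW K0)); lra.
move=> x y; have [xy|/ltW xy] := leP x y.
  by rewrite distrC ger0_norm ?subr_ge0//; exact: H.
by rewrite ger0_norm ?subr_ge0// => ?; rewrite distrC; exact: H.
Qed.

End C0.

(** * Closed function spaces, means along segments, interpolation by hats *)

Section ClosedSubspaces.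
Context {R : realType}.

(** Closedness is phrased by sup-norm approximation, so [T] may be any type and properties such as
    continuity, boundedness or preserving a space under composition give instances. *)
Record closed_subspace (T : Type) (A : set (T -> R)) : Prop := ClosedSubspace {
  cs0 : A (fun=> 0) ;
  csD : forall f g, A f -> A g -> A (fun x => f x + g x) ;
  csZ : forall c f, A f -> A (fun x => c * f x) ;
  cs_lim : forall f, (forall e : R, 0 < e ->
    exists2 g, A g & forall x, `|f x - g x| <= e) -> A f }.

Section Theory.
Context {T : Type} {A : set (T -> R)}.
Hypothesis csA : closed_subspace A.

Lemma csB f g : A f -> A g -> A (fun x => f x - g x).
Proof.
move=> Af Ag; have -> : (fun x => f x - g x) = (fun x => f x + (-1) * g x).
  by apply/funext => x; rewrite mulN1r.
by apply: csD => //; exact: csZ.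
Qed.

Lemma cs_sum (I : Type) (r : seq I) (P : pred I) (F : I -> T -> R) :
  (forall i, P i -> A (F i)) -> A (fun x => \sum_(i <- r | P i) F i x).
Proof.
move=> AF; elim: r => [|i r IH].
  under eq_fun do rewrite big_nil; exact: cs0.
case Pi : (P i); under eq_fun do rewrite big_cons Pi; last exact: IH.
by apply: csD => //; exact: AF.
Qed.

Lemma cs_lspan (S : set (T -> R)) : S `<=` A -> lspan S `<=` A.
Proof.
move=> SA f [k [c [g [Sg ->]]]].
by apply: cs_sum => i _; apply: csZ => //; exact: SA.
Qed.

End Theory.

(* The mean of psi over the segment [a, a + d] when G is a primitive of psi. *)
Definition mean (psi G : R -> R) (a d : R) :=
  if d == 0 then psi a else (G (a + d) - G a) / d.

(** By the mean value theorem each subinterval has an error of at most [e / 2] plus [K] times the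
    variation of [softsign] on it. These variations telescope to less than 2, so [N] depends on
    neither [a] nor [d]. *)
Lemma mean_riemann (psi G : R -> R) : C0R psi -> antiderivative G psi ->
  forall e, 0 < e -> exists N : nat, forall a d,
    `|mean psi G a d -
      N.+1%:R^-1 * \sum_(k < N.+1) psi (a + k%:R / N.+1%:R * d)| <= e.
Proof.
move=> Cpsi Gpsi e e0; have e20 : 0 < e / 2 by rewrite divr_gt0.
have [K K0 HK] := C0R_tame Cpsi e20.
(* Chosen so that the telescoped error [2 * K / N.+1] is at most [e / 2]. *)
pose N := Num.trunc (4 * K / e).
exists N => a d.
have N0 : (0 : R) < N.+1%:R by rewrite ltr0n.
have KN : 4 * K <= e * N.+1%:R.
  by rewrite -ler_pdivrMl// mulrC ltW// truncnS_gt.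
have [d0|d0] := eqVneq d 0.
  rewrite /mean d0 eqxx.
  under eq_bigr do rewrite mulr0 addr0.
  rewrite sumr_const card_ord -(mulr_natl (psi a)) mulKf ?gt_eqF//.
  by rewrite subrr normr0 ltW.
pose x k := a + k%:R / N.+1%:R * d.
have x0 : x 0%N = a by rewrite /x !mul0r addr0.
have xN : x N.+1 = a + d by rewrite /x divff ?gt_eqF// mul1r.
have xS k : x k.+1 = x k + d / N.+1%:R.
  by rewrite /x -natr1; field; rewrite gt_eqF.
have step k : exists2 s, 0 <= s <= 1 &
    G (x k.+1) - G (x k) = psi (x k + s * (d / N.+1%:R)) * (d / N.+1%:R).
  by rewrite xS; exact: mean_value.
(* The sign makes the increments of [softsign] count positively when the segment runs from right to
   left. *)
pose sg : R := if 0 <= d then 1 else -1.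
have term k : `|(G (x k.+1) - G (x k)) / (d / N.+1%:R) - psi (x k)|
    <= e / 2 + K * sg * (softsign (x k.+1) - softsign (x k)).
  have [s /andP[s0 s1] ->] := step k.
  have dN : d / N.+1%:R != 0 by rewrite mulf_neq0// invr_eq0 pnatr_eq0.
  rewrite mulfK//.
  rewrite xS; set D := d / _; rewrite /sg; case: ifPn => d1.
    have D0 : 0 <= D by rewrite divr_ge0// ltW.
    have sD0 : 0 <= s * D by rewrite mulr_ge0.
    have sD1 : s * D <= D by rewrite ler_piMl.
    rewrite distrC mulr1.
    have xD : x k <= x k + s * D by rewrite lerDl.
    apply: le_trans (HK _ _ xD) _.
    rewrite lerD2l ler_pM2l// lerD2r.
    by apply: softsign_le; rewrite lerD2l.
  have D0 : D <= 0.
    rewrite /D mulr_le0_ge0 ?invr_ge0 ?ler0n//.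
    by move: d1; rewrite -ltNge; exact: ltW.
  have sD0 : s * D <= 0 by rewrite mulr_ge0_le0.
  have sD1 : D <= s * D by rewrite ler_niMl.
  have xD : x k + s * D <= x k by rewrite gerDl.
  apply: le_trans (HK _ _ xD) _.
  rewrite mulrN1 mulNr -mulrN opprB lerD2l ler_pM2l// lerD2l lerN2.
  by apply: softsign_le; rewrite lerD2l.
have -> : mean psi G a d - N.+1%:R^-1 * \sum_(k < N.+1) psi (x k) =
    N.+1%:R^-1 * \sum_(k < N.+1)
      ((G (x k.+1) - G (x k)) / (d / N.+1%:R) - psi (x k)).
  rewrite sumrB mulrBr; congr (_ - _).
  rewrite -mulr_suml -(big_mkord xpredT (fun k => G (x k.+1) - G (x k))).
  rewrite telescope_sumr// x0 xN /mean (negbTE d0); field.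
  by rewrite d0 /= gt_eqF.
rewrite normrM normfV (gtr0_norm N0).
rewrite ler_pdivrMl//.
apply: le_trans (ler_norm_sum _ _ _) _.
apply: (@le_trans _ _ (\sum_(k < N.+1)
    (e / 2 + K * sg * (softsign (x k.+1) - softsign (x k))))).
  by apply: ler_sum => k _; exact: term.
rewrite big_split /= sumr_const card_ord -mulr_sumr.
rewrite -(big_mkord xpredT (fun k => softsign (x k.+1) - softsign (x k))).
rewrite telescope_sumr// x0 xN -(mulr_natl (e / 2)).
have : K * sg * (softsign (a + d) - softsign a) <= 2 * K.
  have := softsign_lt1 a; have := softsign_lt1 (a + d).
  rewrite !ltr_norml => /andP[? ?] /andP[? ?].
  rewrite /sg -mulrA [2 * K]mulrC ler_pM2l//; case: ifP => _; lra.
lra.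
Qed.

(** The Riemann sums lie in [A], and they converge uniformly although the endpoints move with [x],
    since [mean_riemann] is uniform in both. *)
Lemma cs_mean (T : Type) (A : set (T -> R)) (psi G : R -> R) (al be : T -> R) :
  closed_subspace A -> C0R psi -> antiderivative G psi ->
  (forall s, A (fun x => psi (al x + s * be x))) ->
  A (fun x => mean psi G (al x) (be x)).
Proof.
move=> csA Cpsi Gpsi Apsi; apply: cs_lim => // e e0.
have [N HN] := mean_riemann Cpsi Gpsi e0.
exists (fun x => N.+1%:R^-1 *
    \sum_(k < N.+1) psi (al x + k%:R / N.+1%:R * be x)) => //.
by apply: csZ => //; apply: cs_sum.
Qed.

(** The tent [max (0, 1 - |t|)], written as half a second difference of the absolute value because
    it arises as a limit of such differences. *)
Definition hat (t : R) := (`|t + 1| - 2 * `|t| + `|t - 1|) / 2.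

Lemma hat_ge0 t : 0 <= hat t.
Proof.
rewrite /hat divr_ge0//.
have := ler_normD (t + 1) (t - 1); have -> : t + 1 + (t - 1) = 2 * t by lra.
by rewrite normrM (@ger0_norm _ 2)//; lra.
Qed.

Lemma hat_eq0 t : 1 <= `|t| -> hat t = 0.
Proof.
by rewrite ler_normr => /orP[] t1; rewrite /hat;
  [rewrite !ger0_norm|rewrite !ler0_norm]; lra.
Qed.

(** The ramp [c] clamps its argument to [[0, 1]], and [hat u = c (u + 1) - c u], so the sum
    telescopes. *)
Lemma sum_hat (K : nat) t : let W := \sum_(k < K.+1) hat (t - k%:R) in
  0 <= W <= 1 /\ (0 <= t <= K%:R -> W = 1).
Proof.
pose c (u : R) := (`|u| - `|u - 1| + 1) / 2.
have -> : \sum_(k < K.+1) hat (t - k%:R) = c (t + 1) - c (t - K%:R).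
  rewrite -(big_mkord xpredT (fun k => hat (t - k%:R))).
  rewrite (eq_bigr (fun k : nat => - c (t + 1 - k.+1%:R) - - c (t + 1 - k%:R))).
    rewrite (telescope_sumr (fun k => - c (t + 1 - k%:R)))// -natr1.
    by rewrite subr0 opprK addrC; congr (_ - c _); lra.
  move=> k _; rewrite -natr1 /hat /c.
  have -> : t + 1 - (k%:R + 1) - 1 = t - k%:R - 1 by lra.
  have -> : t + 1 - (k%:R + 1) = t - k%:R by lra.
  have -> : t + 1 - k%:R - 1 = t - k%:R by lra.
  have -> : t + 1 - k%:R = t - k%:R + 1 by lra.
  lra.
have K0 : 0 <= K%:R :> R by exact: ler0n.
have c01 u : 0 <= c u <= 1.
  rewrite /c; case: (lerP 0 u) => u0; case: (lerP 0 (u - 1)) => u1;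
  rewrite ?(ger0_norm u0) ?(ger0_norm u1) ?(ltr0_norm u0) ?(ltr0_norm u1);
  apply/andP; split; lra.
have c1 u : 1 <= u -> c u = 1 by move=> u1; rewrite /c !ger0_norm; lra.
have c0 u : u <= 0 -> c u = 0 by move=> u1; rewrite /c !ler0_norm; lra.
split=> [|/andP[t0 tK]]; last by rewrite c1 ?c0//; lra.
have /andP[a0 a1] := c01 (t + 1); have /andP[b0 b1] := c01 (t - K%:R).
have [tK|tK] := leP (t - K%:R) 0; first by rewrite (c0 _ tK) subr0 a0 a1.
by rewrite c1; [apply/andP; split; lra|lra].
Qed.

(* By multilinear interpolation of h on a fine grid. *)
Lemma cs_interpolation (T : Type) (A : set (T -> R)) (n : nat)
    (y : T -> 'rV[R]_n) (h : 'rV[R]_n -> R) :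
  closed_subspace A ->
  (forall s (b : 'I_n -> R),
     A (fun x => \prod_i hat (s * y x ord0 i + b i))) ->
  (forall e : R, 0 < e -> exists2 d : R, 0 < d & forall x (z : 'rV[R]_n),
     (forall i, `|y x ord0 i - z ord0 i| <= d) -> `|h (y x) - h z| <= e) ->
  (forall e : R, 0 < e -> exists M : R, forall x i,
     M < `|y x ord0 i| -> `|h (y x)| <= e) ->
  A (fun x => h (y x)).
Proof.
move=> csA Ahat unif van; apply: cs_lim => // e e0.
have e20 : 0 < e / 2 by rewrite divr_gt0.
have [d d0 Hd] := unif _ e20; have [M HM] := van _ e20.
(* The grid has mesh [d] and indices 0 to [2 L], centred at [L]; this [L] makes it cover
   [[- |M|, |M|]] in every coordinate. *)
pose L := (Num.trunc (`|M| / d)).+1.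
have ML : `|M| <= L%:R * d by rewrite -ler_pdivrMr// ltW// truncnS_gt.
pose K := (L + L)%N.
pose z (j : {ffun 'I_n -> 'I_K.+1}) : 'rV[R]_n :=
  \row_i (d * ((j i)%:R - L%:R)).
pose t x i := d^-1 * y x ord0 i + L%:R.
pose w (j : {ffun 'I_n -> 'I_K.+1}) x := \prod_i hat (t x i - (j i)%:R).
exists (fun x => \sum_(j : {ffun 'I_n -> 'I_K.+1}) h (z j) * w j x).
  apply: cs_sum => // j _; apply: csZ => //.
  have := Ahat d^-1 (fun i => L%:R - (j i)%:R).
  by under eq_fun do under eq_bigr do rewrite addrA.
move=> x; pose W := \sum_(j : {ffun 'I_n -> 'I_K.+1}) w j x.
have WE : W = \prod_i \sum_(k < K.+1) hat (t x i - k%:R).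
  by rewrite bigA_distr_bigA.
have W01 : 0 <= W <= 1.
  rewrite WE prodr_ge0 => [/=|i _]; last by have [/andP[]] := sum_hat K (t x i).
  by rewrite Num.Theory.prodr_ile1// => i _; have [] := sum_hat K (t x i).
have w0 j : 0 <= w j x by rewrite prodr_ge0// => i _; exact: hat_ge0.
(* The first term is nonzero only where the weights fail to sum to 1, and there [h (y x)] is small.
   In the second a weight is nonzero only if [z j] is within [d] of [y x] in each coordinate. *)
have -> : h (y x) - \sum_j h (z j) * w j x =
    h (y x) * (1 - W) + \sum_j w j x * (h (y x) - h (z j)).
  have -> : \sum_j w j x * (h (y x) - h (z j)) =
      W * h (y x) - \sum_j h (z j) * w j x.
    rewrite mulr_suml -sumrB; apply: eq_bigr => j _.
    by rewrite mulrBr [w j x * h (z j)]mulrC.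
  by rewrite mulrBr mulr1 [h _ * W]mulrC addrA subrK.
have -> : e = e / 2 + e / 2 by lra.
apply: le_trans (ler_normD _ _) _; apply: lerD.
  have [/forallP /= yM|/forallPn /= [i]] :=
      boolP [forall i, `|y x ord0 i| <= `|M|].
    have -> : W = 1.
      rewrite WE big1// => i _; have [_ ->//] := sum_hat K (t x i).
      have := yM i; have Kd : (K%:R : R) = L%:R + L%:R by rewrite natrD.
      move=> /le_trans /(_ ML); rewrite ler_norml => /andP[y1 y2].
      rewrite /t Kd; apply/andP; split.
        have : - L%:R <= d^-1 * y x ord0 i by rewrite ler_pdivlMl//; lra.
        lra.
      have : d^-1 * y x ord0 i <= L%:R by rewrite ler_pdivrMl//; lra.
      lra.
    by rewrite subrr mulr0 normr0 ltW.
  rewrite -ltNge => yM.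
  have := HM x i (le_lt_trans (ler_norm M) yM) => hx.
  case/andP: W01 => W0 W1; rewrite normrM (@ger0_norm _ (1 - W)); last lra.
  by apply: le_trans hx; rewrite ler_piMr//; lra.
apply: le_trans (ler_norm_sum _ _ _) _.
apply: (@le_trans _ _ (\sum_j w j x * (e / 2))); last first.
  rewrite -mulr_suml; apply: ler_piMl; first exact: ltW.
  by case/andP: W01.
apply: ler_sum => j _; rewrite normrM (ger0_norm (w0 j)).
have [/forallP /= tj|/forallPn /= [i]] :=
    boolP [forall i, `|t x i - (j i)%:R| < 1].
  apply: ler_wpM2l => //; apply: Hd => i; rewrite mxE.
  have -> : y x ord0 i - d * ((j i)%:R - L%:R) = d * (t x i - (j i)%:R).
    by rewrite /t; field; rewrite gt_eqF.
  by rewrite normrM gtr0_norm// ler_piMr ?ltW.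
rewrite -leNgt => /hat_eq0 hi0.
have -> : w j x = 0 by rewrite /w (bigD1 i)//= hi0 mul0r.
by rewrite !mul0r.
Qed.

End ClosedSubspaces.

(** * Affine-invariant closed spaces: from a sigmoid to the hat function *)

Section AffineSubspaces.
Context {R : realType}.
Implicit Types (E : set (R -> R)) (psi F G S : R -> R).

Lemma antiderivative_affine G g (s t : R) : antiderivative G g ->
  antiderivative (fun x => G (s * x + t)) (fun x => s * g (s * x + t)).
Proof.
move=> Gg x; rewrite mulrC.
apply: (@is_derive1_comp _ G (fun x => s * x + t)); first exact: Gg.
rewrite -[X in is_derive _ _ _ X]addr0; apply: is_deriveD.
by have := is_deriveZ s (is_derive_id x (1 : R)); rewrite /GRing.scale /= mulr1.
Qed.

Lemma antiderivative_shift G g (t : R) : antiderivative G g ->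
  antiderivative (fun x => G (x + t)) (fun x => g (x + t)).
Proof.
move=> /(@antiderivative_affine _ _ 1 t).
by under eq_fun do rewrite mul1r; under [X in antiderivative _ X]eq_fun do
  rewrite !mul1r.
Qed.

Lemma antiderivativeB F f G g : antiderivative F f -> antiderivative G g ->
  antiderivative (fun x => F x - G x) (fun x => f x - g x).
Proof. by move=> Ff Gg x; apply: is_deriveB. Qed.

Lemma antiderivativeD F f G g : antiderivative F f -> antiderivative G g ->
  antiderivative (fun x => F x + G x) (fun x => f x + g x).
Proof. by move=> Ff Gg x; apply: is_deriveD. Qed.

Lemma antiderivative_cst G g (c : R) : antiderivative G g ->
  antiderivative (fun x => G x - c) g.
Proof.
by move=> Gg x; rewrite -[X in is_derive _ _ _ X]subr0; apply: is_deriveB.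
Qed.

(** As an instance of [closed_subspace], continuity can be fed to [cs_mean], which then yields the
    continuity of means with moving endpoints. *)
Lemma closed_subspace_continuous (V : normedModType R) :
  closed_subspace [set f : V -> R | continuous f].
Proof.
split => /=.
- by move=> x; exact: cvg_cst.
- by move=> f g cf cg x; apply: cvgD; [exact: cf|exact: cg].
- by move=> c f cf x; apply: cvgM; [exact: cvg_cst|exact: cf].
- move=> f H x; apply/cvgrPdist_lt => e e0.
  have e40 : 0 < e / 4 by rewrite divr_gt0.
  have [g cg fg] := H _ e40.
  have /cvgrPdist_lt/(_ _ e40) := cg x; apply: filterS => y gxy.
  have -> : f x - f y = (f x - g x) + (g x - g y) + (g y - f y) by lra.
  have := ler_normD (f x - g x + (g x - g y)) (g y - f y).
  have := ler_normD (f x - g x) (g x - g y).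
  have := fg x; have := fg y; rewrite (distrC (f y)); lra.
Qed.

Definition affine_closed E :=
  forall psi s t, E psi -> E (fun x => psi (s * x + t)).

(** For nonzero [h] the increment is [h] times the mean of [psi] over the segment from [x] to
    [x + h], a limit of combinations of translates. *)
Lemma cs_increment E psi G (h : R) : closed_subspace E -> affine_closed E ->
  C0R psi -> E psi -> antiderivative G psi -> E (fun x => G (x + h) - G x).
Proof.
move=> csE afE Cpsi Epsi Gpsi.
have [->|h0] := eqVneq h 0.
  by under eq_fun do rewrite addr0 subrr; exact: cs0.
have := cs_mean (al := id) (be := fun=> h) csE Cpsi Gpsi.
move=> /(_ _)/(csZ csE h).
have -> : (fun x => h * mean psi G x h) = (fun x => G (x + h) - G x).
  by apply/funext => x; rewrite /mean (negbTE h0) mulrC divfK.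
apply => s; have := afE _ 1 (s * h) Epsi.
by under eq_fun do rewrite mul1r.
Qed.

(** Cut the segment at [- Y] and [Y]: the outer pieces cost at most [eta] times their length, the
    middle piece at most [2 * B]. *)
Lemma increment_bound (D : R -> R) (eta Y B : R) : 0 <= eta -> 0 <= Y ->
  (forall a b, Y <= a -> a <= b -> `|D b - D a| <= eta * (b - a)) ->
  (forall a b, b <= - Y -> a <= b -> `|D b - D a| <= eta * (b - a)) ->
  (forall a, - Y <= a <= Y -> `|D a| <= B) ->
  forall a b, `|D b - D a| <= eta * `|b - a| + 2 * B.
Proof.
move=> eta0 Y0 DU DL DM.
have B0 : 0 <= B by apply: le_trans (normr_ge0 _) (DM 0 _); rewrite oppr_le0 Y0.
have DMM a b : - Y <= a -> a <= Y -> - Y <= b -> b <= Y ->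
    `|D b - D a| <= 2 * B.
  move=> a1 a2 b1 b2; apply: le_trans (ler_normB _ _) _.
  by rewrite mulr_natl mulr2n; apply: lerD; apply: DM; apply/andP.
have tri (c a b x y : R) : `|D c - D a| <= x -> `|D b - D c| <= y ->
    `|D b - D a| <= x + y.
  move=> ac cb; rewrite -(subrKA (D c)) addrC.
  by apply: le_trans (ler_normD _ _) _; apply: lerD.
have etaD u v : 0 <= v -> eta * u <= eta * (u + v).
  by move=> v0; rewrite ler_wpM2l// lerDl.
move=> a b; wlog ab : a b / a <= b.
  move=> H; have [/H//|/ltW/H] := leP a b.
  by rewrite distrC [`|a - b|]distrC.
rewrite (@ger0_norm _ (b - a)) ?subr_ge0//.
have NYY : - Y <= Y by rewrite ge0_cp.
have [aL|/ltW aL] := leP a (- Y); have [bL|/ltW bL] := leP b (- Y).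
- by apply: le_trans (DL a b bL ab) _; rewrite lerDl mulr_ge0.
- have [bU|bU] := leP b Y.
    apply: le_trans (tri _ _ _ _ _ (DL a _ (lexx _) aL)
      (DMM _ b _ _ bL bU)) _ => //.
    rewrite lerD2r; have -> : b - a = - Y - a + (b + Y) by lra.
    by apply: etaD; lra.
  apply: le_trans (tri _ _ _ _ _ (tri _ _ _ _ _ (DL a _ (lexx _) aL)
    (DMM _ Y _ _ _ _)) (DU Y b (lexx _) (ltW bU))) _ => //.
  rewrite addrAC lerD2r -mulrDr.
  have -> : b - a = - Y - a + (b - Y) + 2 * Y by lra.
  by apply: etaD; lra.
- by rewrite (le_anti (_ : a <= b <= a)) ?subrr ?normr0 ?addr_ge0 ?mulr_ge0//
    ab (le_trans bL aL).
- have [aU|/ltW aU] := leP a Y; have [bU|/ltW bU] := leP b Y.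
  + apply: le_trans (DMM a b _ _ _ _) _ => //.
    by rewrite lerDr mulr_ge0 ?subr_ge0.
  + apply: le_trans (tri _ _ _ _ _ (DMM a Y _ _ _ _)
      (DU Y b (lexx _) bU)) _ => //.
    rewrite addrC lerD2r; have -> : b - a = b - Y + (Y - a) by lra.
    by apply: etaD; lra.
  + by rewrite (le_anti (_ : a <= b <= a)) ?subrr ?normr0 ?addr_ge0 ?mulr_ge0//
      ab (le_trans bU aU).
  + apply: le_trans (DU a b aU ab) _.
    by rewrite lerDl mulr_ge0 ?mulr_ge0 ?subr_ge0.
Qed.

(** Far out the slope of [G - c |.|] is [S - c] or [S + c], hence at most [eta] in absolute value;
    the bounded middle part goes into [B]. *)
Lemma sigmoid_primitive_growth S G (c : R) : antiderivative G S ->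
  (forall eta : R, 0 < eta -> exists Y : R, forall y, Y < y ->
     `|S y - c| <= eta /\ `|S (- y) + c| <= eta) ->
  forall eta : R, 0 < eta -> exists B : R, forall a b,
    `|(G b - c * `|b|) - (G a - c * `|a|)| <= eta * `|b - a| + B.
Proof.
move=> GS lim eta eta0; have [Y0 HY0] := lim _ eta0.
pose Y := `|Y0| + 1; have Y_gt0 : 0 < Y by rewrite ltr_wpDl.
have HY y : Y <= y -> `|S y - c| <= eta /\ `|S (- y) + c| <= eta.
  by move=> Yy; apply: HY0; move: Yy; rewrite /Y; have := ler_norm Y0; lra.
pose D y := G y - c * `|y|.
have inc (X d : R) : `|X| <= eta -> 0 <= d -> `|X * d| <= eta * d.
  by move=> Xe d0; rewrite normrM (ger0_norm d0) ler_wpM2r.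
have DU a b : Y <= a -> a <= b -> `|D b - D a| <= eta * (b - a).
  move=> Ya ab; have [s /andP[s0 s1]] := mean_value GS a (b - a).
  rewrite subrKC => GE; set xi := a + s * (b - a) in GE.
  have -> : D b - D a = (S xi - c) * (b - a).
    by rewrite /D !ger0_norm; lra.
  apply: inc; last lra; apply: (HY _ _).1; apply: le_trans Ya _.
  by rewrite lerDl mulr_ge0//; lra.
have DL a b : b <= - Y -> a <= b -> `|D b - D a| <= eta * (b - a).
  move=> Yb ab; have [s /andP[s0 s1]] := mean_value GS a (b - a).
  rewrite subrKC => GE; set xi := a + s * (b - a) in GE.
  have -> : D b - D a = (S xi + c) * (b - a).
    by rewrite /D !ler0_norm; lra.
  apply: inc; last lra; rewrite -[xi]opprK; apply: (HY _ _).2.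
  rewrite lerNr; apply: le_trans _ Yb.
  have : s * (b - a) <= b - a by rewrite ler_piMl//; lra.
  rewrite /xi; lra.
have cnG : {within `[- Y, Y], continuous (fun x => `|G x|)}.
  apply: continuous_subspaceT => x; apply: (@cvg_norm _ _ _ _ _ G).
  exact: (antiderivative_continuous GS).
have [m _ Hm] := EVT_max (f := fun x => `|G x|) (a := - Y) (b := Y)
  ltac:(lra) cnG.
pose B0 := `|G m| + `|c| * Y.
have DM a : - Y <= a <= Y -> `|D a| <= B0.
  move=> aY; have := Hm a; rewrite in_itv /= => /(_ aY) Ga.
  apply: le_trans (ler_normB _ _) _; apply: lerD => //.
  by rewrite normrM normr_id ler_wpM2l// ler_norml.
by exists (2 * B0); exact: increment_bound (ltW eta0) (ltW Y_gt0) DU DL DM.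
Qed.

(** At large scale [s], [G] differs from [c |.|] by sublinear increments, so its second difference
    of step [s], divided by [2 c s], tends to that of the absolute value. It lies in [E] by two uses
    of [cs_increment]; the second is possible because increments of [S] vanish at infinity. *)
Lemma hat_in E psi S (c : R) : closed_subspace E -> affine_closed E ->
  C0R psi -> E psi -> antiderivative S psi -> c != 0 ->
  (forall eta : R, 0 < eta -> exists Y : R, forall y, Y < y ->
     `|S y - c| <= eta /\ `|S (- y) + c| <= eta) ->
  E hat.
Proof.
move=> csE afE Cpsi Epsi Spsi c0 lim.
have cS := antiderivative_continuous Spsi.
have [G GS] := antiderivative_exists cS.
have C0inc (s : R) : C0R (fun x => S (x + s) - S x).
  split.
    move=> x; apply: cvgB; last exact: cS.
    apply: (@continuous_comp _ _ _ (fun x => x + s) S); last exact: cS.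
    by apply: cvgD; [exact: cvg_id|exact: cvg_cst].
  move=> e e0; have [|Y HY] := lim (e / 3); first by rewrite divr_gt0.
  exists (`|Y| + `|s|) => x _; rewrite lter_normr => xY.
  have := ler_norm Y; have := ler_norm s; have := lerNnormlW (lexx `|s|).
  move=> s1 s2 Y1; case/orP: xY => xY.
    have [/ler_normlP[? ?] _] := HY x ltac:(have := normr_ge0 s; lra).
    have [/ler_normlP[? ?] _] := HY (x + s) ltac:(lra).
    rewrite ltr_norml; apply/andP; split; lra.
  have [_] := HY (- x) ltac:(have := normr_ge0 s; lra).
  have [_] := HY (- (x + s)) ltac:(lra).
  rewrite !opprK => /ler_normlP[? ?] /ler_normlP[? ?].
  rewrite ltr_norml; apply/andP; split; lra.
have diff2 (s : R) : E (fun x => G (x + s + s) - G (x + s) - (G (x + s) - G x)).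
  apply: (cs_increment (psi := fun x => S (x + s) - S x)
    (G := fun x => G (x + s) - G x)) => //.
    exact: cs_increment csE afE Cpsi Epsi Spsi.
  by apply: antiderivativeB => //; exact: antiderivative_shift.
apply: cs_lim => // e e0.
have ec0 : 0 < e * `|c| / 2 by rewrite divr_gt0// mulr_gt0// normr_gt0.
have [B HB] := sigmoid_primitive_growth GS lim ec0.
(* The two increments of [D] add up to at most [e |c| s + 2 B]; this [s] gives [2 B <= e |c| s], and
   dividing by [2 |c| s] leaves at most [e]. *)
pose s := 2 * `|B| / (e * `|c|) + 1.
have s0 : 0 < s by rewrite ltr_wpDl// divr_ge0// ?mulr_ge0// ltW.
exists (fun t => (2 * c * s)^-1 * (G (s * t + - s + s + s) - G (s * t + - s + s)
    - (G (s * t + - s + s) - G (s * t + - s)))).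
  by apply: csZ => //; exact: (afE _ s (- s) (diff2 s)).
move=> t; rewrite !subrK.
pose D y := G y - c * `|y|.
have -> : hat t - (2 * c * s)^-1 *
      (G (s * t + s) - G (s * t) - (G (s * t) - G (s * t + - s))) =
    - (2 * c * s)^-1 *
      ((D (s * t + s) - D (s * t)) - (D (s * t) - D (s * t - s))).
  have -> : hat t = (`|s * t + s| - 2 * `|s * t| + `|s * t - s|) / (2 * s).
    have -> : s * t + s = s * (t + 1) by lra.
    have -> : s * t - s = s * (t - 1) by lra.
    rewrite !normrM (gtr0_norm s0) /hat; field; rewrite gt_eqF//.
  by rewrite /D; field; rewrite c0 gt_eqF.
rewrite normrM normrN normfV !normrM (@ger0_norm _ 2)// (gtr0_norm s0).
rewrite ler_pdivrMl; last by rewrite !mulr_gt0// normr_gt0.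
have := HB (s * t) (s * t + s); have := HB (s * t - s) (s * t).
have -> : s * t + s - s * t = s by lra.
have -> : s * t - (s * t - s) = s by lra.
rewrite (gtr0_norm s0) -!/(D _) => h1 h2.
have := ler_normB (D (s * t + s) - D (s * t)) (D (s * t) - D (s * t - s)).
have Bs : 2 * B <= s * (e * `|c|).
  have -> : s * (e * `|c|) = 2 * `|B| + e * `|c|.
    by rewrite /s; field; rewrite normr_eq0 c0 gt_eqF.
  have := ler_norm B; lra.
lra.
Qed.

End AffineSubspaces.

(** * Density of affine-invariant closed spaces in the functions vanishing at infinity *)

Section AffineDensity.
Context {R : realType}.
Implicit Types (E : set (R -> R)) (phi psi S u v : R -> R).

Lemma C0R_shift phi (a : R) : C0R phi -> C0R (fun x => phi (x + a)).
Proof.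
move=> [cf vf]; split.
  move=> x; apply: (@continuous_comp _ _ _ (fun x => x + a) phi); last first.
    exact: cf.
  by apply: cvgD; [exact: cvg_id|exact: cvg_cst].
move=> e /vf[M HM]; exists (M + `|a|) => x _ Mx; apply: HM => //.
have := lerB_normD x a; lra.
Qed.

Lemma C0RB phi psi : C0R phi -> C0R psi -> C0R (fun x => phi x - psi x).
Proof.
move=> [cf vf] [cg vg]; split.
  by move=> x; apply: cvgB; [exact: cf|exact: cg].
move=> e e0; have e20 : 0 < e / 2 by rewrite divr_gt0.
have [M HM] := vf _ e20; have [N HN] := vg _ e20.
exists (Num.max M N) => x _; rewrite gt_max => /andP[Mx Nx].
apply: le_lt_trans (ler_normB _ _) _.
have := HM x I Mx; have := HN x I Nx; lra.
Qed.

(** Two uses of the mean value theorem; the second difference of [F2] thereby inherits decay and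
    local sign from [phi]. *)
Lemma second_difference_primitive phi (F1 F2 : R -> R) (h : R) :
  antiderivative F1 phi -> antiderivative F2 F1 ->
  forall x, exists2 s, 0 <= s <= 2 &
    F2 (x + h + h) - F2 (x + h) - (F2 (x + h) - F2 x) =
    h ^+ 2 * phi (x + s * h).
Proof.
move=> F1phi F2F1 x.
have dF : antiderivative (fun y => F2 (y + h) - F2 y)
    (fun y => F1 (y + h) - F1 y).
  by apply: antiderivativeB => //; exact: antiderivative_shift.
have [s1 /andP[s10 s11] E1] := mean_value dF x h.
have [s2 /andP[s20 s21] E2] := mean_value F1phi (x + s1 * h) h.
exists (s1 + s2); first by apply/andP; split; lra.
by rewrite E1 E2 mulrDl addrA expr2; lra.
Qed.

(* Integration by parts: [S x - v x / x] is the integral of the nonpositive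
   [v y / y ^ 2] over [0, x]. *)
Lemma sigmoid_limit psi S v (v' : R -> R) (C U a0 : R) :
  (forall x, `|psi x| <= C) -> antiderivative S psi -> S 0 = 0 ->
  antiderivative v v' -> (forall x, v' x = x * psi x) -> v 0 = 0 ->
  (forall x, v x <= 0) -> (forall x, `|v x| <= U) ->
  (forall x, a0 < x -> v x < 0) ->
  exists2 c : R, c < 0 & forall eta, 0 < eta ->
    exists Y : R, forall y, Y < y -> `|S y - c| <= eta.
Proof.
move=> Cpsi Spsi S0 vv' v'E v0 v_le0 vU v_lt0.
have C0 : 0 <= C by exact: le_trans (normr_ge0 (psi 0)) (Cpsi 0).
have U0 : 0 <= U by exact: le_trans (normr_ge0 (v 0)) (vU 0).
pose J x := S x - v x / x.
(* The parameter [al] is used twice: [al = 0] makes [J] nonincreasing, and [al = U] makes the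
   integrand nonnegative and bounds [J] from below. *)
have Jinc (al a b : R) : 0 < a -> a < b -> exists2 x, a < x < b &
    (J b - al / b) - (J a - al / a) = (v x + al) / x ^+ 2 * (b - a).
  move=> a_gt0 ab.
  have dJ (x : R) : 0 < x ->
      is_derive x 1 (fun y => S y - (v y + al) * y^-1) ((v x + al) / x ^+ 2).
    move=> x0; have xn0 : x != 0 by rewrite gt_eqF.
    have dva : is_derive x 1 (fun y => v y + al) (v' x + 0).
      exact: is_deriveD.
    have := is_deriveB (Spsi x)
      (is_deriveM dva (is_deriveV xn0 (is_derive_id x (1 : R)))).
    congr (is_derive _ _ _ _); rewrite /GRing.scale /= v'E; field.
    by [].
  have [||x] := MVT (f := fun y => S y - (v y + al) * y^-1)
      (df := fun x => (v x + al) / x ^+ 2) ab.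
  - move=> x; rewrite in_itv /= => /andP[ax _]; apply: dJ.
    exact: lt_trans ax.
  - apply: derivable_within_continuous => x; rewrite in_itv /= => /andP[ax _].
    by have [] := dJ x (lt_le_trans a_gt0 ax).
  - rewrite in_itv /= => xab JE; exists x => //; rewrite -JE /J !mulrDl; lra.
have Jnincr a b : 0 < a -> a < b -> J b <= J a.
  move=> a_gt0 ab; have [x /andP[ax xb]] := Jinc 0 a b a_gt0 ab.
  rewrite !mul0r !subr0 addr0 => JE; rewrite -subr_le0 JE.
  rewrite mulr_le0_ge0//; last lra.
  by rewrite mulr_le0_ge0// invr_ge0 sqr_ge0.
have Jsmall x : 0 < x -> J x <= 2 * C * x.
  move=> x0.
  have [s /andP[s0 s1]] := mean_value Spsi 0 x.
  rewrite add0r S0 subr0 add0r => SE.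
  have [r /andP[r0 r1]] := mean_value vv' 0 x.
  rewrite add0r v0 subr0 add0r v'E => vE.
  rewrite /J vE mulfK ?gt_eqF// SE.
  have /ler_normlP[p1 p2] := Cpsi (s * x).
  have /ler_normlP[q1 q2] := Cpsi (r * x).
  have : psi (s * x) * x <= C * x by rewrite ler_pM2r.
  have : r * x * (- psi (r * x)) <= x * C.
    apply: (@le_trans _ _ (r * x * C)).
      by rewrite ler_wpM2l// mulr_ge0// ltW.
    by rewrite ler_wpM2r// ler_piMl// ltW.
  lra.
have J_le0 x : 0 < x -> J x <= 0.
  move=> x0; rewrite leNgt; apply/negP => Jx.
  (* Since [J y <= 2 C y], this choice forces [J y < J x] with [y < x], against monotonicity. *)
  pose y := Num.min (x / 2) (J x / (2 * C + 1) / 2).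
  have C1 : 0 < 2 * C + 1 by lra.
  have y0 : 0 < y by rewrite lt_min !divr_gt0.
  have yx : y < x by rewrite gt_min; apply/orP; left; lra.
  have : y <= J x / (2 * C + 1) / 2 by rewrite ge_min lexx orbT.
  rewrite !ler_pdivlMr// => h.
  have := Jnincr y x y0 yx; have := Jsmall y y0; lra.
have Jlb x : 0 < x -> J 1 - U <= J x.
  move=> x0; have [x1|x1|->] := ltgtP x 1; last lra.
    by have := Jnincr x 1 x0 x1; lra.
  have [y /andP[y1 _]] := Jinc U 1 x ltr01 x1; rewrite divr1 => JE.
  have : 0 <= (v y + U) / y ^+ 2 * (x - 1).
    rewrite mulr_ge0//; last lra.
    rewrite divr_ge0 ?sqr_ge0//; have /ler_normlP[] := vU y; lra.
  have : 0 <= U / x by rewrite divr_ge0// ltW.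
  lra.
pose Js := [set J x | x in [set x : R | 0 < x]].
have Js0 : Js !=set0 by exists (J 1), 1 => //=; rewrite ltr01.
have Jslb : has_lbound Js by exists (J 1 - U) => _ [x /= x0 <-]; exact: Jlb.
have cJ x : 0 < x -> inf Js <= J x by move=> x0; apply: ge_inf => //; exists x.
(* [J] decreases to its infimum and [v y / y] tends to 0, so [S] has the same limit. It is negative
   because [J] starts at most 0 and drops strictly where [v < 0]. *)
exists (inf Js).
  pose b := `|a0| + 1; have b0 : 0 < b by rewrite ltr_wpDl.
  have [|x /andP[bx _]] := Jinc 0 b (b + 1) b0; first lra.
  rewrite !mul0r !subr0 addr0 => JE.
  have : v x / x ^+ 2 * (b + 1 - b) < 0.
    rewrite pmulr_llt0; last lra.
    rewrite pmulr_llt0 ?invr_gt0 ?exprn_gt0//; last exact: lt_trans bx.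
    by apply: v_lt0; move: bx; rewrite /b; have := ler_norm a0; lra.
  by have := J_le0 b b0; have := cJ (b + 1) ltac:(lra); lra.
move=> eta eta0; have eta20 : 0 < eta / 2 by rewrite divr_gt0.
have [_ [x /= x0 <-] Jx] := inf_adherent eta20 (conj Js0 Jslb).
exists (Num.max x (2 * U / eta)) => y; rewrite gt_max => /andP[xy Uy].
have y0 : 0 < y by exact: lt_trans xy.
have -> : S y = J y + v y / y by rewrite /J subrK.
have vy : `|v y / y| <= eta / 2.
  rewrite normrM normfV (gtr0_norm y0) ler_pdivrMr//.
  move: Uy; rewrite ltr_pdivrMr//; have := vU y; lra.
have := cJ y y0; have := Jnincr x y x0 xy => j1 j2.
move: vy; rewrite !ler_norml => /andP[? ?]; apply/andP; split; lra.
Qed.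

Lemma odd_primitive psi S : antiderivative S psi -> S 0 = 0 ->
  (forall x, psi (- x) = psi x) -> forall x, S (- x) = - S x.
Proof.
move=> Spsi S0 even x.
have dS : antiderivative (fun y => S (-1 * y + 0) + S y)
    (fun y => -1 * psi (-1 * y + 0) + psi y).
  by apply: antiderivativeD => //; exact: antiderivative_affine.
have [s _] := mean_value dS 0 x.
rewrite !add0r !mulN1r !addr0 oppr0 S0 addr0 subr0 even addNr mul0r.
by move/eqP; rewrite addr_eq0 => /eqP.
Qed.

Lemma C0R_max u x0 : C0R u -> 0 < u x0 ->
  exists2 t, 0 < u t & forall x, u x <= u t.
Proof.
move=> [cu vu] ux0; have [M HM] := vu _ ux0.
pose m := `|M| + `|x0|; have M0 := normr_ge0 M; have x00 := normr_ge0 x0.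
have cuw : {within `[- m, m], continuous u} by exact: continuous_subspaceT.
have [t _ Ht] := EVT_max (f := u) (a := - m) (b := m)
  ltac:(rewrite /m; lra) cuw.
have tx0 : u x0 <= u t.
  by apply: Ht; rewrite in_itv /= -ler_norml /m; lra.
exists t; first exact: lt_le_trans tx0.
move=> x; have [xm|xm] := leP `|x| m.
  by apply: Ht; rewrite in_itv /= -ler_norml.
have := HM x I; have := ler_norm M; have := ler_norm (u x).
rewrite /m in xm => h1 h2 /(_ ltac:(lra)); lra.
Qed.

(** Maximality of [u] at [t] makes [v], half the symmetric second difference of [u] at [t],
    nonpositive, and [v' x = x * psi x]. So [sigmoid_limit] applies to the primitive [S] of [psi];
    oddness of [S] gives the opposite limit at the other end, as [hat_in] requires. *)
Lemma hat_in_of_max E u (u1 u2 : R -> R) (t : R) :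
  closed_subspace E -> affine_closed E ->
  C0R u2 -> E u2 -> antiderivative u1 u2 -> antiderivative u u1 -> C0R u ->
  (exists B, forall x, `|u1 x| <= B) ->
  (forall x, u x <= u t) -> 0 < u t -> E hat.
Proof.
move=> csE afE C0u2 Eu2 u1u2 uu1 C0u [B HB] tmax ut0.
(* As a mean of [u2] over the segment from [t - x] to [t + x], the quotient also has the right value
   at [x = 0]. *)
pose psi x := mean u2 u1 (t - x) (2 * x).
have psiE (x : R) : x != 0 -> psi x = (u1 (t + x) - u1 (t - x)) / (2 * x).
  move=> x0; rewrite /psi /mean mulf_eq0 (negbTE x0) pnatr_eq0 /=.
  by congr ((u1 _ - _) / _); lra.
have Epsi : E psi.
  apply: cs_mean => // s; have := afE _ (2 * s - 1) t Eu2.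
  by congr E; apply/funext => x; congr u2; lra.
have cu2 (a b : R) : continuous (fun x : R => u2 (x * a + b)).
  move=> x; apply: (@continuous_comp _ _ _ (fun x : R => x * a + b) u2).
    apply: cvgD; last exact: cvg_cst.
    by apply: cvgM; [exact: cvg_id|exact: cvg_cst].
  exact: C0u2.1.
have cpsi : continuous psi.
  have := cs_mean (al := fun x : R => t - x) (be := fun x => 2 * x)
    (@closed_subspace_continuous R R) C0u2 u1u2.
  apply => s /=.
  have -> : (fun x => u2 (t - x + s * (2 * x))) =
      (fun x => u2 (x * (2 * s - 1) + t)).
    by apply/funext => y; congr u2; lra.
  exact: cu2.
have B0 : 0 <= B by exact: le_trans (normr_ge0 (u1 0)) (HB 0).
have C0psi : C0R psi.
  split=> // e e0; exists (B / e) => x _ xB.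
  have xn0 : 0 < `|x| by apply: le_lt_trans xB; rewrite divr_ge0// ltW.
  rewrite psiE -?normr_gt0// normrM normfV normrM (@ger0_norm _ 2)//.
  rewrite ltr_pdivrMr ?mulr_gt0//.
  apply: le_lt_trans (ler_normB _ _) _; move: xB; rewrite ltr_pdivrMr//.
  have := HB (t + x); have := HB (t - x); lra.
have even x : psi (- x) = psi x.
  have [->|x0] := eqVneq x 0; first by rewrite oppr0.
  rewrite !psiE ?oppr_eq0// opprK mulrN invrN mulrN -mulNr opprB.
  by [].
have [S0 S0psi] := antiderivative_exists cpsi.
pose S x := S0 x - S0 0.
have Spsi : antiderivative S psi by exact: antiderivative_cst.
have S00 : S 0 = 0 by rewrite /S subrr.
have Sodd := odd_primitive Spsi S00 even.
have [C C0 HC] := C0R_bounded C0psi; have [U U0 HU] := C0R_bounded C0u.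
pose v x := (u (1 * x + t) + u (-1 * x + t) - 2 * u t) / 2.
pose v' x := (1 * u1 (1 * x + t) + -1 * u1 (-1 * x + t)) / 2.
have vv' : antiderivative v v'.
  move=> x.
  have d := antiderivative_cst (2 * u t) (antiderivativeD
    (antiderivative_affine 1 t uu1) (antiderivative_affine (-1) t uu1)) x.
  have := is_deriveZ (2^-1 : R) d.
  rewrite /v /v' /GRing.scale /= => H.
  rewrite [X in is_derive _ _ _ X]mulrC.
  by under eq_fun do rewrite mulrC.
have v'E x : v' x = x * psi x.
  rewrite /v' !mul1r !mulN1r [x + t]addrC [- x + t]addrC.
  have [->|x0] := eqVneq x 0; first by rewrite oppr0 subrr !mul0r.
  by rewrite psiE//; field.
(* Beyond [|M| + |t|] both translates of [u] are below [u t / 2], so [v] is strictly negative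
   there. *)
have [M HM] := C0u.2 _ (ltac:(rewrite divr_gt0//) : 0 < u t / 2).
have [|x|x|x Mx|c c0 Hc] := sigmoid_limit (a0 := `|M| + `|t|) (U := 2 * U)
    HC Spsi S00 vv' v'E.
- by rewrite /v !mulr0 !add0r; lra.
- by rewrite /v; have := tmax (1 * x + t); have := tmax (-1 * x + t); lra.
- rewrite /v ler_norml; have := HU (1 * x + t); have := HU (-1 * x + t).
  have := HU t; rewrite !ler_norml => /andP[? ?] /andP[? ?] /andP[? ?].
  by apply/andP; split; lra.
- have M1 := ler_norm M; have M0 := normr_ge0 M; have t0 := normr_ge0 t.
  have x0 : 0 < x by lra.
  have /ltr_normlP[_ h1] : `|u (1 * x + t)| < u t / 2.
    apply: HM => //; rewrite mul1r.
    have := lerB_normD x t; rewrite (gtr0_norm x0); lra.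
  have /ltr_normlP[_ h2] : `|u (-1 * x + t)| < u t / 2.
    apply: HM => //; rewrite mulN1r.
    have := lerB_normD (- x) t; rewrite normrN (gtr0_norm x0); lra.
  by rewrite /v; lra.
apply: (hat_in csE afE C0psi Epsi Spsi (c := c)); first by rewrite lt_eqF.
move=> eta eta0; have [Y HY] := Hc _ eta0; exists Y => y Yy.
by split; [exact: HY|rewrite Sodd addrC -opprB normrN; exact: HY].
Qed.

Lemma cs_C0R_of_hat E : closed_subspace E -> affine_closed E -> E hat ->
  @C0R R `<=` E.
Proof.
move=> csE afE Ehat f C0f.
pose y (x : R) : 'rV[R]_1 := \row_i x.
have -> : f = (fun x => f (y x ord0 ord0)) by apply/funext => x; rewrite mxE.
apply: (cs_interpolation (y := y) (h := fun z => f (z ord0 ord0))) => //.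
- move=> s b; under eq_fun do rewrite big_ord1 mxE.
  exact: (afE _ s (b ord0) Ehat).
- move=> e e0; have [d d0 Hd] := C0R_unif C0f e0; exists d => // x z xz.
  by apply/ltW/Hd; exact: xz.
- move=> e e0; have [M HM] := C0f.2 _ e0; exists M => x i.
  by rewrite !mxE => Mx; exact/ltW/HM.
Qed.

Lemma affine_density E phi : closed_subspace E -> affine_closed E ->
  C0R phi -> E phi -> phi <> (fun=> 0) -> @C0R R `<=` E.
Proof.
move=> csE afE; wlog [x0 phi0] : phi / exists x0, 0 < phi x0.
  move=> H C0phi Ephi phin0.
  have [x0 /eqP px0] : exists x0, phi x0 <> 0.
    by apply/existsNP => phi0; apply: phin0; apply/funext.
  have [p0|p0|p0] := ltgtP (phi x0) 0; last by rewrite p0 eqxx in px0.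
    apply: (H (fun x => -1 * phi x)).
    - by exists x0; rewrite mulN1r oppr_gt0.
    - split; first by move=> x; apply: cvgM; [exact: cvg_cst|exact: C0phi.1].
      move=> e /(C0phi.2)[M HM]; exists M => x _ Mx.
      by rewrite mulN1r normrN; exact: HM.
    - exact: csZ.
    - by move=> /(congr1 (@^~ x0))/eqP; rewrite mulN1r oppr_eq0 lt_eqF.
  by apply: (H phi) => //; exists x0.
move=> C0phi Ephi _.
apply: cs_C0R_of_hat => //.
have [F1 dF1] := antiderivative_exists C0phi.1.
have [F2 dF2] := antiderivative_exists (antiderivative_continuous dF1).
have [d d0 Hd] := C0R_unif C0phi phi0.
(* The second difference at [x0] is [h ^ 2] times a value of [phi] within [2 h = d] of [x0], which
   is positive by the choice of [d]. *)
pose h := d / 2; have h0 : 0 < h by rewrite divr_gt0.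
pose diff2 (F : R -> R) x := F (x + h + h) - F (x + h) - (F (x + h) - F x).
have ddiff2 F f : antiderivative F f -> antiderivative (diff2 F) (diff2 f).
  move=> Ff; have s1 := antiderivative_shift h Ff.
  have s2 := antiderivative_shift h s1.
  by apply: antiderivativeB; apply: antiderivativeB.
have uE := second_difference_primitive h dF1 dF2.
have C0van g : continuous g -> (forall x, exists2 s, 0 <= s <= 2 &
    `|g x| <= h ^+ 2 * `|phi (x + s * h)|) -> C0R g.
  move=> cg gphi; split => // e e0.
  have [M HM] := C0phi.2 (e / h ^+ 2) (divr_gt0 e0 (exprn_gt0 _ h0)).
  exists (`|M| + 2 * h) => x _ Mx; have [s /andP[s0 s2] sE] := gphi x.
  apply: le_lt_trans sE _; rewrite -ltr_pdivlMl ?exprn_gt0// [_ * e]mulrC.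
  apply: HM => //.
  have := lerB_normD x (s * h); have sh0 : 0 <= s * h by rewrite mulr_ge0// ltW.
  have sh2 : s * h <= 2 * h by rewrite ler_pM2r.
  rewrite (ger0_norm sh0); have := ler_norm M; lra.
have C0u : C0R (diff2 F2).
  apply: C0van.
    exact: (antiderivative_continuous (ddiff2 _ _ dF2)).
  move=> x; have [s s02 sE] := uE x; exists s => //.
  by rewrite /diff2 sE normrM ger0_norm// sqr_ge0.
have [t ut tmax] : exists2 t, 0 < diff2 F2 t &
    forall x, diff2 F2 x <= diff2 F2 t.
  apply: (C0R_max (x0 := x0)) => //.
  have [s /andP[s0 s2] sE] := uE x0; rewrite /diff2 sE mulr_gt0 ?exprn_gt0//.
  have sh0 : 0 <= s * h by rewrite mulr_ge0// ltW.
  have sh2 : s * h <= d.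
    have : s * h <= 2 * h by rewrite ler_pM2r.
    rewrite /h; lra.
  have := Hd x0 (x0 + s * h).
  rewrite opprD addrA subrr add0r normrN (ger0_norm sh0) => /(_ sh2).
  by move=> /ltr_normlP[]; lra.
apply: (hat_in_of_max (t := t) csE afE _ _ (ddiff2 _ _ dF1)
  (ddiff2 _ _ dF2)) => //.
- have s1 := C0R_shift h C0phi; have s2 := C0R_shift h s1.
  exact: (C0RB (C0RB s2 s1) (C0RB s1 C0phi)).
- have Es : E (fun x => phi (x + h)).
    by have := afE _ 1 h Ephi; under eq_fun do rewrite mul1r.
  have Ess : E (fun x => phi (x + h + h)).
    by have := afE _ 1 h Es; under eq_fun do rewrite mul1r.
  by apply: csB => //; apply: csB.
- have [C C0 HC] := C0R_bounded C0phi; exists (2 * (C * h)) => x.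
  have [s1 _ E1] := mean_value dF1 x h.
  have [s2 _ E2] := mean_value dF1 (x + h) h.
  rewrite /diff2 E1 E2; apply: le_trans (ler_normB _ _) _.
  rewrite !(normrM (phi _)) (gtr0_norm h0).
  have := HC (x + h + s2 * h); have := HC (x + s1 * h).
  move=> /(ler_wpM2r (ltW h0)) ? /(ler_wpM2r (ltW h0)) ?; lra.
Qed.

End AffineDensity.

(** * Uniformly closed algebras and products of Cauchy kernels *)

Section UniformAlgebras.
Context {R : realType}.

Lemma lspanD (T : Type) (S : set (T -> R)) f g :
  lspan S f -> lspan S g -> lspan S (fun x => f x + g x).
Proof.
move=> [k [c [F [SF ->]]]] [l [d [G [SG ->]]]].
exists (k + l)%N.
exists (fun i : 'I_(k + l) =>
  match fintype.split i with inl j => c j | inr j => d j end).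
exists (fun i : 'I_(k + l) =>
  match fintype.split i with inl j => F j | inr j => G j end).
split=> [i|]; first by case: (fintype.split i) => j.
apply/funext => x; rewrite big_split_ord /=.
congr (_ + _); apply: eq_bigr => i _.
  by rewrite -[lshift l i]/(unsplit (inl i)) unsplitK.
by rewrite -[rshift k i]/(unsplit (inr i)) unsplitK.
Qed.

Lemma lspanZ (T : Type) (S : set (T -> R)) (a : R) f :
  lspan S f -> lspan S (fun x => a * f x).
Proof.
move=> [k [c [F [SF ->]]]]; exists k, (fun i => a * c i), F; split=> //.
by apply/funext => x; rewrite mulr_sumr; apply: eq_bigr => i _; rewrite mulrA.
Qed.

Lemma lspan_sub (T : Type) (S : set (T -> R)) : S `<=` lspan S.
Proof.
move=> f Sf; exists 1%N, (fun=> 1), (fun=> f); split=> //.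
by apply/funext => x; rewrite big_ord1 mul1r.
Qed.

Lemma uniform_closure_sub (T : choiceType) (S : set (T -> R)) :
  S `<=` uniform_closure S.
Proof. exact: (@subset_closure {uniform T -> R}). Qed.

Lemma cs_uniform_closure (T : Type) (A : set (T -> R)) : closed_subspace A ->
  forall f, (forall e : R, 0 < e ->
    exists2 g, A g & forall x, `|f x - g x| < e) -> A f.
Proof.
move=> csA f H; apply: cs_lim => // e /H[g Ag fg].
by exists g => // x; exact/ltW/fg.
Qed.

Lemma uniform_closure_min (T : choiceType) (S A : set (T -> R)) :
  closed_subspace A -> S `<=` A -> uniform_closure S `<=` A.
Proof.
move=> csA SA f /uniform_closureP H.
apply: cs_uniform_closure => // e /H[g Sg fg].
by exists g => //; exact: SA.
Qed.

Lemma closed_subspace_closure (T : choiceType) (S : set (T -> R)) :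
  closed_subspace (uniform_closure (lspan S)).
Proof.
split.
- apply: uniform_closure_sub.
  exists 0%N, (fun=> 0), (fun _ _ => 0); split=> [[]//|].
  by apply/funext => x; rewrite big_ord0.
- move=> f g /uniform_closureP Hf /uniform_closureP Hg.
  apply/uniform_closureP => e e0; have e20 : 0 < e / 2 by rewrite divr_gt0.
  have [f' Sf' ff'] := Hf _ e20; have [g' Sg' gg'] := Hg _ e20.
  exists (fun x => f' x + g' x); first exact: lspanD.
  move=> x; rewrite opprD addrACA; apply: le_lt_trans (ler_normD _ _) _.
  have := ff' x; have := gg' x; lra.
- move=> c f /uniform_closureP Hf; apply/uniform_closureP => e e0.
  have c0 : 0 < `|c| + 1 by rewrite ltr_wpDl.
  have [f' Sf' ff'] := Hf _ (divr_gt0 e0 c0).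
  exists (fun x => c * f' x); first exact: lspanZ.
  move=> x; rewrite -mulrBr normrM.
  have := ff' x; rewrite ltr_pdivlMr// mulrDr mulr1 mulrC.
  have := normr_ge0 (f x - f' x); lra.
- move=> f H; apply/uniform_closureP => e e0.
  have e20 : 0 < e / 2 by rewrite divr_gt0.
  have [g /uniform_closureP Hg fg] := H _ e20; have [h Sh gh] := Hg _ e20.
  exists h => // x; rewrite -(subrKA (g x)).
  apply: le_lt_trans (ler_normD _ _) _.
  have := fg x; have := gh x; lra.
Qed.

Lemma closed_subspace_bounded (T : Type) :
  closed_subspace [set f : T -> R | exists C, forall x, `|f x| <= C].
Proof.
split => /=.
- by exists 0 => x; rewrite normr0.
- move=> f g [C HC] [D HD]; exists (C + D) => x.
  by apply: le_trans (ler_normD _ _) _; exact: lerD.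
- move=> c f [C HC]; exists (`|c| * C) => x.
  by rewrite normrM ler_wpM2l.
- move=> f /(_ _ ltr01)[g [C HC] fg]; exists (1 + C) => x.
  rewrite -(subrK (g x) (f x)); apply: le_trans (ler_normD _ _) _.
  exact: lerD.
Qed.

(** Multiplication by a bounded function is continuous in the sup norm, so stability under products
    need only be checked on generators. *)
Lemma closed_subspace_multiplier (T : Type) (A : set (T -> R)) g :
  closed_subspace A -> (exists C, forall x, `|g x| <= C) ->
  closed_subspace [set f | A (fun x => f x * g x)].
Proof.
move=> csA [C HC]; split => /=.
- by under eq_fun do rewrite mul0r; exact: cs0.
- by move=> f h Af Ah; under eq_fun do rewrite mulrDl; exact: csD.
- by move=> c f Af; under eq_fun do rewrite -mulrA; exact: csZ.
- move=> f H; apply: cs_lim => // e e0.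
  have C0 : 0 < `|C| + 1 by rewrite ltr_wpDl.
  have [h Ah fh] := H _ (divr_gt0 e0 C0).
  exists (fun x => h x * g x) => // x; rewrite -mulrBl normrM.
  have gC : `|g x| <= `|C| + 1 by have := HC x; have := ler_norm C; lra.
  apply: le_trans (ler_pM (normr_ge0 _) (normr_ge0 _) (fh x) gC) _.
  by rewrite divfK// gt_eqF.
Qed.

Record uniform_algebra (T : Type) (A : set (T -> R)) : Prop := UniformAlgebra {
  ua_cs : closed_subspace A ;
  ua_bounded : A `<=` [set f | exists C, forall x, `|f x| <= C] ;
  ua_one : A (fun=> 1) ;
  ua_mul : forall f g, A f -> A g -> A (fun x => f x * g x) }.

Definition cauchy_kernel (t : R) := (1 + t ^+ 2)^-1.

Let den_gt0 (t : R) : 0 < 1 + t ^+ 2.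
Proof. by have := sqr_ge0 t; lra. Qed.

Lemma cauchy_kernel_le1 t : 0 < cauchy_kernel t <= 1.
Proof.
rewrite invr_gt0 den_gt0 invf_le1//; have := sqr_ge0 t; lra.
Qed.

Lemma cauchy_kernel_continuous : continuous cauchy_kernel.
Proof.
move=> t; apply: cvgV; first by rewrite gt_eqF.
apply: cvgD; first exact: cvg_cst.
exact: exprn_continuous.
Qed.

Lemma cauchy_kernel_lt (e t : R) : 0 < e -> e^-1 + 1 < `|t| ->
  cauchy_kernel t < e.
Proof.
move=> e0 te; rewrite -[e]invrK ltf_pV2 ?posrE ?invr_gt0//.
have ei : 0 < e^-1 by rewrite invr_gt0.
have : `|t| <= `|t| * `|t| by rewrite ler_peMr//; lra.
rewrite -normrM ger0_norm -?expr2 ?sqr_ge0//; lra.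
Qed.

Lemma C0R_cauchy_kernel : C0R cauchy_kernel.
Proof.
split; first exact: cauchy_kernel_continuous.
move=> e e0; exists (e^-1 + 1) => t _ te.
have /andP[k0 _] := cauchy_kernel_le1 t.
by rewrite gtr0_norm// cauchy_kernel_lt.
Qed.

Lemma cauchy_kernel_neq0 : cauchy_kernel <> fun=> 0.
Proof.
move=> /(congr1 (@^~ 0))/eqP; have /andP[k0 _] := cauchy_kernel_le1 0.
by rewrite gt_eqF.
Qed.

(* The Neumann series of [c^-1 / (1 - (1 - (1 + f ^ 2) / c))]. *)
Lemma ua_cauchy_kernel (T : Type) (A : set (T -> R)) f :
  uniform_algebra A -> A f -> A (fun x => cauchy_kernel (f x)).
Proof.
move=> uaA Af; have csA := ua_cs uaA.
have [C HC] := ua_bounded uaA Af.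
pose c := 1 + C ^+ 2; have c0 : 0 < c by exact: den_gt0.
pose r x := 1 - (1 + f x ^+ 2) / c.
have Ar : A r.
  apply: csB => //; first exact: ua_one.
  under eq_fun do rewrite mulrC; apply: csZ => //.
  apply: csD => //; first exact: ua_one.
  by under eq_fun do rewrite expr2; exact: ua_mul.
have ArX k : A (fun x => r x ^+ k).
  elim: k => [|k IH]; first by under eq_fun do rewrite expr0; exact: ua_one.
  by under eq_fun do rewrite exprS; exact: ua_mul.
(* From [1 <= 1 + f ^ 2 <= c] follows [0 <= r <= rho < 1], so the geometric series converges
   uniformly. *)
pose rho := 1 - c^-1.
have c1 : c^-1 <= 1 by rewrite invf_le1// lerDl sqr_ge0.
have ci : 0 < c^-1 by rewrite invr_gt0.
have r0 x : 0 <= r x.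
  rewrite subr_ge0 ler_pdivrMr// mul1r lerD2l -real_normK ?num_real//.
  have C0 : 0 <= C by exact: le_trans (HC x).
  by rewrite ler_pXn2r ?nnegrE.
have rrho x : r x <= rho.
  rewrite lerD2l lerN2 ler_pdivlMr// mulVf ?gt_eqF// lerDl.
  exact: sqr_ge0.
have rhoN : (fun k => rho ^+ k) @ \oo --> (0 : R).
  by apply: cvg_expr; rewrite ger0_norm /rho; lra.
apply: cs_lim => // e e0.
have /cvgrPdist_lt/(_ _ e0)[N _ HN] := rhoN.
exists (fun x => c^-1 * \sum_(k < N) r x ^+ k).
  by apply: csZ => //; apply: cs_sum.
move=> x.
have E : c^-1 * (\sum_(k < N) r x ^+ k) = (1 - r x ^+ N) * cauchy_kernel (f x).
  have h : 1 - r x ^+ N = (1 - r x) * \sum_(k < N) r x ^+ k.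
    by rewrite -opprB subrX1 -mulNr opprB.
  have r1 : 1 - r x = (1 + f x ^+ 2) / c by rewrite subKr.
  rewrite h r1 /cauchy_kernel.
  by field; rewrite !gt_eqF.
rewrite E mulrBl mul1r opprB addrC subrK.
have /andP[k0 k1] := cauchy_kernel_le1 (f x).
rewrite ger0_norm; last by rewrite mulr_ge0 ?exprn_ge0// ltW.
apply: (@le_trans _ _ (r x ^+ N)); first by rewrite ler_piMr// exprn_ge0.
have := HN N (leqnn N); rewrite /= sub0r normrN => /ltW; apply: le_trans.
apply: le_trans (ler_norm _); rewrite lerXn2r ?nnegrE//.
exact: le_trans (rrho x).
Qed.

(** The functions preserving [A] under composition form a closed space, affine-invariant since [A]
    contains the constants. It contains the Cauchy kernel, so [affine_density] applies. *)
Lemma ua_comp (T : Type) (A : set (T -> R)) psi f :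
  uniform_algebra A -> C0R psi -> A f -> A (fun x => psi (f x)).
Proof.
move=> uaA C0psi; have csA := ua_cs uaA.
suff /(_ psi C0psi) :
    @C0R R `<=` [set psi | forall f, A f -> A (fun x => psi (f x))].
  exact.
apply: (affine_density (phi := cauchy_kernel)).
- split => /=.
  + by move=> g _; exact: cs0.
  + by move=> p q Ap Aq g Ag; apply: csD => //; [exact: Ap|exact: Aq].
  + by move=> c p Ap g Ag; apply: csZ => //; exact: Ap.
  + move=> p H g Ag; apply: cs_lim => // e /H[q Aq pq].
    by exists (fun x => q (g x)) => //; exact: Aq.
- move=> p s t Ap g Ag /=; apply: (Ap (fun x => s * g x + t)).
  apply: csD => //; first exact: csZ.
  have := csZ csA t (ua_one uaA).
  by under eq_fun do rewrite mulr1.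
- exact: C0R_cauchy_kernel.
- by move=> g Ag; exact: ua_cauchy_kernel.
- exact: cauchy_kernel_neq0.
Qed.

Lemma ua_prod (T : Type) (A : set (T -> R)) (I : Type) (s : seq I)
    (F : I -> T -> R) :
  uniform_algebra A -> (forall i, A (F i)) -> A (fun x => \prod_(i <- s) F i x).
Proof.
move=> uaA AF; elim: s => [|i s IH].
  by under eq_fun do rewrite big_nil; exact: ua_one.
by under eq_fun do rewrite big_cons; exact: ua_mul.
Qed.

(* Feynman's parametrization: [1 / ((1 + i t) (1 + i u))] is the mean of
   [1 / (1 + i s) ^ 2] over the segment from t to u. Its real part, taken at u
   and at - u, gives the product of the real parts. *)
Lemma cauchy_kernel_mul (T : Type) (A : set (T -> R)) (al be : T -> R) :
  closed_subspace A ->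
  (forall psi (r s : R), C0R psi -> A (fun x => psi (r * al x + s * be x))) ->
  A (fun x => cauchy_kernel (al x) * cauchy_kernel (be x)).
Proof.
move=> csA Aridge.
(* [psi t] is the real part of [1 / (1 + i t) ^ 2], and [G] is its primitive [t / (1 + t ^ 2)]. *)
pose psi (t : R) := (1 - t ^+ 2) * cauchy_kernel t ^+ 2.
pose G (t : R) := t * cauchy_kernel t.
have Gpsi : antiderivative G psi.
  move=> t; have dn0 : 1 + t ^+ 2 != 0 by rewrite gt_eqF.
  have dt := is_derive_id t (1 : R).
  have dd : is_derive t (1 : R) (fun y : R => 1 + y ^+ 2)
      (0 + (t *: 1 + t *: 1)).
    under eq_fun do rewrite expr2.
    exact: (is_deriveD (is_derive_cst (1 : R) t (1 : R)) (is_deriveM dt dt)).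
  have := is_deriveM dt (@is_deriveV _ (fun y : R => 1 + y ^+ 2) t _ _ dn0 dd).
  congr (is_derive _ _ _ _).
  by rewrite /psi /cauchy_kernel /GRing.scale /=; field.
have C0psi : C0R psi.
  split.
    move=> t; apply: cvgM.
      by apply: cvgB; [exact: cvg_cst|exact: exprn_continuous].
    apply: (@continuous_comp _ _ _ cauchy_kernel (fun y : R => y ^+ 2)).
      exact: cauchy_kernel_continuous.
    exact: exprn_continuous.
  move=> e e0; exists (e^-1 + 1) => t _ te.
  have /andP[k0 k1] := cauchy_kernel_le1 t.
  apply: le_lt_trans (cauchy_kernel_lt e0 te).
  rewrite /psi normrM [cauchy_kernel t ^+ 2]expr2 normrM (gtr0_norm k0) mulrA.
  apply: ler_piMl; first exact: ltW.
  rewrite /cauchy_kernel ler_pdivrMr// mul1r; apply: le_trans (ler_normB _ _) _.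
  by rewrite normr1 ger0_norm ?sqr_ge0.
have meanE t u : mean psi G t (u - t) =
    (1 - t * u) * (cauchy_kernel t * cauchy_kernel u).
  rewrite /mean subr_eq0; case: eqVneq => [->|ut].
    by rewrite /psi !expr2.
  rewrite subrKC /G /cauchy_kernel; field.
  by rewrite subr_eq0 ut /= !gt_eqF.
have Amean (c : R) : A (fun x => mean psi G (al x) (c * be x - al x)).
  apply: cs_mean => // s; have := Aridge psi (1 - s) (s * c) C0psi.
  by congr A; apply/funext => x; congr psi; lra.
(* The factors [1 - t u] and [1 + t u] of the two means add up to 2. *)
have := csZ csA 2^-1 (csD csA (Amean 1) (Amean (-1))).
congr A; apply/funext => x; rewrite !meanE mul1r mulN1r.
have -> : cauchy_kernel (- be x) = cauchy_kernel (be x).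
  by rewrite /cauchy_kernel sqrrN.
lra.
Qed.

End UniformAlgebras.

(** * Networks on Euclidean space and the resolvent algebra *)

Section Networks.
Context {R : realType}.

Lemma continuous_normP (V : normedModType R) (f : V -> R) :
  (forall x (e : R), 0 < e ->
    exists2 d : R, 0 < d & forall y, `|x - y| < d -> `|f x - f y| < e) ->
  continuous f.
Proof.
move=> H x; apply/cvgrPdist_lt => e /(H x)[d d0 Hd].
by apply/nbhs_normP; exists d.
Qed.

Lemma within_continuous_norm (V : normedModType R) (A : set V) (f : V -> R) :
  {within A, continuous f} -> forall x (e : R), A x -> 0 < e ->
  exists2 d : R, 0 < d &
    forall y, A y -> `|x - y| < d -> `|f x - f y| < e.
Proof.
move=> /subspace_continuousP H x e Ax e0.
have /cvgrPdist_lt/(_ _ e0)/nbhs_normP[d /= d0 Hd] := H x Ax.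
by exists d => // y Ay xy; exact: Hd.
Qed.

Section Dot.
Context {n : nat}.
Implicit Types u v w x : 'rV[R]_n.

Lemma dotC u v : dot u v = dot v u.
Proof. by apply: eq_bigr => i _; rewrite mulrC. Qed.

Lemma dotDl u v w : dot (u + v) w = dot u w + dot v w.
Proof. by rewrite -big_split; apply: eq_bigr => i _; rewrite mxE mulrDl. Qed.

Lemma dotZl (a : R) u w : dot (a *: u) w = a * dot u w.
Proof. by rewrite mulr_sumr; apply: eq_bigr => i _; rewrite mxE mulrA. Qed.

Lemma dotBl u v w : dot (u - v) w = dot u w - dot v w.
Proof. by rewrite dotDl -scaleN1r dotZl mulN1r. Qed.

Lemma dot0l w : dot 0 w = 0.
Proof. by rewrite -(scale0r w) dotZl mul0r. Qed.

Lemma dot_ge0 u : 0 <= dot u u.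
Proof. by apply: sumr_ge0 => i _; rewrite -expr2 sqr_ge0. Qed.

Lemma dot_eq0 u : dot u u = 0 -> u = 0.
Proof.
move=> /eqP; rewrite psumr_eq0 => [/allP uu|i _]; last first.
  by rewrite -expr2 sqr_ge0.
apply/rowP => i; have := uu i (mem_index_enum i).
by rewrite mulf_eq0 orbb mxE => /eqP.
Qed.

Lemma ler_coord_enorm u i : `|u ord0 i| <= enorm u.
Proof.
rewrite /enorm -sqrtr_sqr ler_wsqrtr// /dot (bigD1 i)//= expr2 lerDl.
by apply: sumr_ge0 => j _; rewrite -expr2 sqr_ge0.
Qed.

Lemma dot_continuous u : continuous (dot u : 'rV[R]_n -> R).
Proof.
have cs := @closed_subspace_continuous R 'rV[R]_n.
have dE := @cs_sum R 'rV[R]_n _ cs 'I_n (index_enum _) xpredT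
  (fun i x => u ord0 i * x ord0 i).
apply: dE => i _.
apply: (csZ cs (u ord0 i) (f := fun x => x ord0 i)) => x.
exact: coord_continuous.
Qed.

Lemma ler_coord_norm x i : `|x ord0 i| <= `|x|.
Proof.
by rewrite {2}/Num.norm /= mx_normrE; exact: (le_bigmax _ _ (ord0, i)).
Qed.

Lemma norm_le_coord x (r : R) : 0 <= r -> (forall i, `|x ord0 i| <= r) ->
  `|x| <= r.
Proof.
move=> r0 xr; rewrite {1}/Num.norm /= mx_normrE; apply: bigmax_le => //.
by move=> [i j] _ /=; rewrite ord1.
Qed.

Lemma ler_dot u x : `|dot u x| <= (\sum_i `|u ord0 i|) * `|x|.
Proof.
rewrite mulr_suml; apply: le_trans (ler_norm_sum _ _ _) _.
by apply: ler_sum => i _; rewrite normrM ler_wpM2l// ler_coord_norm.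
Qed.

Lemma orthoproj_unique (V : {vspace 'rV[R]_n}) P x w : is_orthoproj V P ->
  w \in V -> (forall v, v \in V -> dot (x - w) v = 0) -> w = P x.
Proof.
move=> PV wV xw; have [PxV xP] := PV x.
have wPV : w - P x \in V by rewrite memvB.
apply/eqP; rewrite -subr_eq0; apply/eqP/dot_eq0.
have -> : dot (w - P x) (w - P x) =
    dot (x - P x) (w - P x) - dot (x - w) (w - P x).
  have wE : x - P x - (x - w) = w - P x by rewrite opprB addrC subrKA.
  by rewrite -dotBl wE.
by rewrite xP// xw// subrr.
Qed.

(** Linearity of [P] comes from uniqueness: the combination of the images of the basis vectors also
    satisfies the characterization of [P x]. *)
Lemma orthoproj_coord (V : {vspace 'rV[R]_n}) P : is_orthoproj V P ->
  exists a : 'I_n -> 'rV[R]_n, forall x i, P x ord0 i = dot (a i) x.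
Proof.
move=> PV; exists (fun i => \row_j P (delta_mx 0 j) ord0 i) => x i.
have <- : \sum_j x ord0 j *: P (delta_mx 0 j) = P x.
  apply: (orthoproj_unique PV) => [|v vV].
    by apply: memv_suml => j _; apply: memvZ; have [] := PV (delta_mx 0 j).
  rewrite {1}(row_sum_delta x) -sumrB dotC /dot.
  rewrite (eq_bigr (fun k => \sum_j v ord0 k *
      (x ord0 j * (delta_mx 0 j - P (delta_mx 0 j)) ord0 k))).
    rewrite exchange_big big1//= => j _.
    have [_ /(_ _ vV)] := PV (delta_mx 0 j); rewrite dotC => vj0.
    transitivity (x ord0 j * dot v (delta_mx 0 j - P (delta_mx 0 j))).
      by rewrite mulr_sumr; apply: eq_bigr => k _; rewrite mulrCA.
    by rewrite vj0 mulr0.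
  move=> k _; rewrite summxE mulr_sumr; apply: eq_bigr => j _.
  by rewrite !mxE; congr (_ * _); rewrite mulrBr.
by rewrite summxE; apply: eq_bigr => j _; rewrite !mxE mulrC.
Qed.

End Dot.

Lemma hat_C0R : C0R (@hat R).
Proof.
split.
  have cn (a : R) : continuous (fun t : R => `|t + a|).
    move=> t; apply: (@cvg_norm _ _ _ _ _ (fun t : R => t + a)).
    by apply: cvgD; [exact: cvg_id|exact: cvg_cst].
  move=> t; apply: cvgM; last exact: cvg_cst.
  apply: cvgD; last exact: (cn (-1)).
  apply: cvgB; first exact: (cn 1).
  by apply: cvgM; [exact: cvg_cst|exact: norm_continuous].
by move=> e e0; exists 1 => t _ t1; rewrite hat_eq0 ?normr0// ltW.
Qed.

(** [affine_density] is applied to the functions all of whose ridge functions lie in [A]; an affine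
    substitution only changes [a] and [b]. *)
Lemma ridge_density n (A : set ('rV[R]_n -> R)) phi : closed_subspace A ->
  C0R phi -> phi <> (fun=> 0) -> (forall a b, A (fun x => phi (dot a x + b))) ->
  forall psi, C0R psi -> forall a b, A (fun x => psi (dot a x + b)).
Proof.
move=> csA C0phi phin0 Aphi psi C0psi.
have : @C0R R `<=` [set psi | forall a b, A (fun x => psi (dot a x + b))].
  apply: (affine_density (phi := phi)) => //.
  - split => /=.
    + by move=> a b; exact: cs0.
    + by move=> f g Af Ag a b; apply: csD.
    + by move=> c f Af a b; apply: csZ.
    + move=> f H a b; apply: cs_lim => // e /H[g Ag fg].
      by exists (fun x => g (dot a x + b)) => //; exact: Ag.
  - move=> f s t Af a b /=; have := Af (s *: a) (s * b + t).
    by congr A; apply/funext => x; rewrite dotZl mulrDr addrA.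
by move=> /(_ psi C0psi).
Qed.

(** * The closure of the one-layer networks as an algebra *)

Section Algebra.
Context (phi : R -> R) (n : nat).
Hypotheses (C0phi : C0R phi) (phin0 : phi <> fun=> 0).

Let A := uniform_closure (@network R phi n 1).

Let csA : closed_subspace A.
Proof. exact: closed_subspace_closure. Qed.

Lemma network1_ridge psi : C0R psi ->
  forall a b, A (fun x => psi (dot a x + b)).
Proof.
move=> C0psi; apply: (ridge_density csA C0phi) => // a b.
by apply/uniform_closure_sub/lspan_sub; exists a, b.
Qed.

(** By [ridge_density] the Cauchy ridge functions generate [A] as well, whatever [phi] is, so closed
    properties of [A] need checking only on them. *)
Lemma network1_min (B : set ('rV[R]_n -> R)) : closed_subspace B ->
  (forall a b, B (fun x => cauchy_kernel (dot a x + b))) -> A `<=` B.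
Proof.
move=> csB Bk; apply: uniform_closure_min => //.
apply: cs_lspan => // _ [a [b ->]].
exact: (ridge_density csB C0R_cauchy_kernel cauchy_kernel_neq0 Bk).
Qed.

Lemma network1_algebra : uniform_algebra A.
Proof.
have bd : A `<=` [set f | exists C, forall x, `|f x| <= C].
  apply: network1_min; first exact: closed_subspace_bounded.
  move=> a b; exists 1 => x.
  have /andP[k0 k1] := cauchy_kernel_le1 (dot a x + b).
  by rewrite gtr0_norm.
have Ak a b : A (fun x => cauchy_kernel (dot a x + b)).
  exact/network1_ridge/C0R_cauchy_kernel.
(* Products are extended one factor at a time: first [f] runs through [A] against a fixed Cauchy
   ridge function, then the other factor does. *)
have mulk a b f : A f -> A (fun x => f x * cauchy_kernel (dot a x + b)).
  apply: (network1_min (B := [set f |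
    A (fun x => f x * cauchy_kernel (dot a x + b))])).
    by apply: closed_subspace_multiplier => //; exact: bd.
  move=> a' b'; apply: cauchy_kernel_mul => // psi r s C0psi.
  have := @network1_ridge psi C0psi (r *: a' + s *: a) (r * b' + s * b).
  by congr A; apply/funext => x; rewrite dotDl !dotZl; congr psi; lra.
split=> //.
- have := Ak 0 0; congr A; apply/funext => x.
  by rewrite dot0l addr0 /cauchy_kernel expr0n addr0 invr1.
- move=> f g Af; apply: (network1_min (B := [set g | A (fun x => f x * g x)])).
    have := closed_subspace_multiplier csA (bd _ Af).
    congr closed_subspace; apply/funext => h /=.
    by under eq_fun do rewrite mulrC.
  by move=> a b; exact: mulk.
Qed.

Lemma network_sub l : network phi l `<=` A.
Proof.
case: l => [//|]; elim=> [|l IH]; first exact: uniform_closure_sub.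
apply: cs_lspan => // _ [f [b [/IH Af ->]]].
apply: (ua_comp network1_algebra C0phi (f := fun x => f x + b)).
apply: (csD csA (g := fun=> b)) => //.
have := csZ csA b (ua_one network1_algebra).
by under eq_fun do rewrite mulr1.
Qed.

Lemma network1_resolvent : A `<=` @resolvent_algebra R n.
Proof.
apply: uniform_closure_min; first exact: closed_subspace_closure.
apply: cs_lspan; first exact: closed_subspace_closure.
move=> _ [a [b ->]]; apply/uniform_closure_sub/lspan_sub.
have daa : dot a a = 0 -> a = 0 by exact: dot_eq0.
(* For [a = 0] the division by 0 gives 0, and the map is the projection onto the zero subspace. *)
exists <[a]>%VS, (fun x => (dot a x / dot a a) *: a),
  (fun x => phi (dot a x + b)).
split.
- move=> x; split; first by rewrite memvZ ?memv_line.
  move=> _ /vlineP[k ->]; rewrite dotC dotZl dotC dotBl dotZl [dot x a]dotC.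
  have [/daa ->|a0] := eqVneq (dot a a) 0.
    by rewrite !dot0l mulr0 subrr mulr0.
  by rewrite divfK// subrr mulr0.
- split.
    apply: continuous_subspaceT => x.
    apply: (@continuous_comp _ _ _ (fun x => dot a x + b) phi); last first.
      exact: C0phi.1.
    have cs := @closed_subspace_continuous R 'rV[R]_n.
    apply: (csD cs (f := dot a) (g := fun=> b)) => y.
      exact: dot_continuous.
    exact: cst_continuous.
  (* On the line, [|a . x|] is the product of the norms of [a] and [x]. If [a = 0] this radius is 0
     and no point of the line exceeds it. *)
  move=> e /(C0phi.2)[M HM]; exists ((`|M| + `|b|) / enorm a).
  move=> _ /= /vlineP[k ->]; set x := k *: a => Mx; apply: HM => //.
  have xE : dot a x = k * enorm a ^+ 2.
    by rewrite dotC dotZl sqr_sqrtr ?dot_ge0.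
  have nx : enorm x = `|k| * enorm a.
    rewrite /enorm dotZl dotC dotZl mulrA -expr2 sqrtrM ?sqr_ge0//.
    by rewrite sqrtr_sqr.
  have na0 : 0 <= enorm a by rewrite sqrtr_ge0.
  have na : 0 < enorm a.
    rewrite lt_neqAle na0 andbT; apply/eqP => a0.
    by move: Mx; rewrite nx -a0 invr0 !mulr0 ltxx.
  move: Mx; rewrite ltr_pdivrMr// nx -mulrA -expr2 => Mx.
  apply: le_lt_trans (ler_norm M) _.
  have := lerB_normD (dot a x) b; rewrite xE normrM (ger0_norm (sqr_ge0 _)).
  lra.
- apply/funext => x /=; congr (phi (_ + b)).
  have -> : dot a ((dot a x / dot a a) *: a) = dot a x / dot a a * dot a a.
    by rewrite dotC dotZl.
  have [/daa ->|a0] := eqVneq (dot a a) 0; last by rewrite divfK.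
  by rewrite !dot0l mulr0.
Qed.

Lemma resolvent_network1 : @resolvent_algebra R n `<=` A.
Proof.
apply: uniform_closure_min => //.
apply: cs_lspan => // _ [V [P [g [PV C0g ->]]]].
have [cg vg] := C0g; have [a aE] := orthoproj_coord PV.
have PinV x : P x \in V by have [] := PV x.
have PP w : w \in V -> P w = w.
  by move=> wV; apply/esym/(orthoproj_unique PV) => // v _; rewrite subrr dot0l.
pose C := \sum_i \sum_j `|a i ord0 j|.
have C0 : 0 <= C by apply: sumr_ge0 => i _; exact: sumr_ge0.
have PC x z : `|P x - P z| <= C * `|x - z|.
  apply: norm_le_coord => [|i]; first by rewrite mulr_ge0.
  rewrite !mxE !aE dotC [dot _ z]dotC -dotBl dotC.
  apply: le_trans (ler_dot _ _) _; apply: ler_wpM2r => //.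
  rewrite /C [leRHS](bigD1 i)//= lerDl.
  by apply: sumr_ge0 => k _; exact: sumr_ge0.
(* Grid points need not lie in [V], where alone [g] is controlled; [h] agrees with [g] on [V] and is
   continuous everywhere. *)
pose h := g \o P.
have ch : continuous h.
  apply: (continuous_normP (V := 'rV[R]_n)) => x e e0.
  have [d d0 Hd] := within_continuous_norm (V := 'rV[R]_n) cg (PinV x) e0.
  exists (d / (C + 1)); first by rewrite divr_gt0 ?ltr_wpDl.
  move=> z xz; apply: Hd (PinV z) _; apply: le_lt_trans (PC x z) _.
  move: xz; rewrite ltr_pdivlMr ?ltr_wpDl//.
  have := normr_ge0 (x - z); lra.
have -> : g \o P = (fun x => h (P x)).
  by apply/funext => x; rewrite /h /= (PP _ (PinV x)).
apply: (cs_interpolation csA (y := P) (h := h)).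
- move=> s b.
  apply: (@ua_prod R _ A _ _ (fun i x => hat (s * P x ord0 i + b i))
    network1_algebra) => i.
  have := @network1_ridge _ hat_C0R (s *: a i) (b i).
  by congr A; apply/funext => x; rewrite dotZl aE.
- move=> e e0; have e20 : 0 < e / 2 by rewrite divr_gt0.
  have [M HM] := vg _ e20.
  pose r := `|M| + 1.
  have cK := @rV_compact R n (fun=> `[- r, r]%classic)
    (fun=> @segment_compact R (- r) r).
  have [d0 d00 Hd] := heine cK ch e0.
  (* The first bound serves inside the cube of radius [r]. Outside it, the second keeps [P z] within
     1 of [P x], so both have norm above [|M|] and both values of [h] are below [e / 2]. *)
  pose d := Num.min (d0 / 2) (C + 1)^-1.
  have C1 : 0 < C + 1 by rewrite ltr_wpDl.
  have dgt0 : 0 < d by rewrite lt_min invr_gt0 C1 divr_gt0.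
  exists d => // x z xz.
  have {}xz : `|P x - z| <= d.
    by apply: norm_le_coord => [|i]; [exact: ltW|rewrite !mxE].
  have [xK|xK] := leP `|P x| r.
    apply/ltW/Hd.
      move=> i /=; rewrite in_itv /= -ler_norml.
      exact: le_trans (ler_coord_norm _ _) xK.
    apply: le_lt_trans xz _.
    by rewrite gt_min; apply/orP; left; lra.
  have bigV w : `|M| < `|w| -> w \in V -> `|h w| < e / 2.
    move=> Mw wV; rewrite /h /= PP//; apply: HM => //.
    apply: le_lt_trans (ler_norm M) _; apply: lt_le_trans Mw _.
    by apply: norm_le_coord => [|i]; [exact: sqrtr_ge0|exact: ler_coord_enorm].
  have hx : `|h (P x)| < e / 2 by apply: bigV => //; rewrite /r in xK; lra.
  have hz : `|h z| < e / 2.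
    have -> : h z = h (P z) by rewrite /h /= (PP _ (PinV z)).
    apply: bigV => //.
    have := PC (P x) z; rewrite (PP _ (PinV x)).
    have : C * `|P x - z| <= 1.
      apply: (@le_trans _ _ ((C + 1) * (C + 1)^-1)); last first.
        by rewrite divff// gt_eqF.
      apply: ler_pM => //; first lra.
      by apply: le_trans xz _; rewrite ge_min lexx orbT.
    have := lerB_dist (P x) (P z); rewrite /r in xK; lra.
  apply: le_trans (ler_normB _ _) _; lra.
- move=> e /vg[M HM]; exists M => x i Mx; rewrite /h /= (PP _ (PinV x)).
  apply/ltW/HM; first exact: PinV.
  exact: lt_le_trans Mx (ler_coord_enorm _ _).
Qed.

End Algebra.
End Networks.

Theorem theorem4p5 (R : realType) (n : nat) (phi : R -> R) :
  (0 < n)%N -> C0R phi -> phi <> (fun _ : R => 0) ->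
  [/\ uniform_closure (@network_oo R phi n)
        = uniform_closure (@network R phi n 1),
      uniform_closure (@network R phi n 1) = @resolvent_algebra R n &
      forall m : nat, (0 < m)%N ->
        uniform_closure (@network_multi_oo R phi n m)
          = components_in (m := m) (@resolvent_algebra R n)].
Proof.
move=> _ C0phi phin0.
have csA : closed_subspace (uniform_closure (@network R phi n 1)).
  exact: closed_subspace_closure.
have resE : uniform_closure (@network R phi n 1) = @resolvent_algebra R n.
  rewrite eqEsubset; split; first exact: network1_resolvent.
  exact: resolvent_network1.
split=> // [|m _].
- rewrite eqEsubset; split.
    by apply: uniform_closure_min => // f [l _]; exact: network_sub.
  by apply: (@closureS {uniform 'rV[R]_n -> R}) => f Nf; exists 1%N.
rewrite -resE eqEsubset; split => F.
  move=> /uniform_closureP HF j; apply: cs_uniform_closure => // e e0.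
  have [G [l _ NG] FG] := HF _ e0.
  exists (fun x => G x ord0 j); first exact: (network_sub C0phi phin0 (NG j)).
  move=> x; apply: le_lt_trans (FG x).
  by have := ler_coord_norm (F x - G x) j; rewrite !mxE.
move=> HF; apply/uniform_closureP => e e0.
(* Halving restores strictness: [norm_le_coord] bounds the norm of a vector only non-strictly. *)
have e20 : 0 < e / 2 by rewrite divr_gt0.
have /choice[g Hg] (j : 'I_m) : exists g, @network R phi n 1 g /\
    forall x, `|F x ord0 j - g x| < e / 2.
  by have /uniform_closureP/(_ _ e20)[g Ng Fg] := HF j; exists g.
exists (fun x => \row_j g j x).
  (* All components are approximated at depth 1, so they share one layer count, as [network_multi]
     demands. *)
  exists 1%N => // j.
  have -> : (fun x => (\row_j g j x) ord0 j) = g j.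
    by apply/funext => x; rewrite mxE.
  by have [] := Hg j.
move=> x; apply: (@le_lt_trans _ _ (e / 2)); last lra.
apply: norm_le_coord => [|j]; first exact: ltW.
by rewrite !mxE; have [_ /(_ x)/ltW] := Hg j.
Qed.
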